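(* Let $n$ and $m$ be integers with $3\le m\le n/2$. The $\mathbb{Q}\mathcal{S}_n$-module $S_{\mathbb{Q}}^{(n-m,m)}$ does not contain a unimodular $\mathbb{Z}\mathcal{S}_n$-lattice.
   Context: For a partition $\lambda$ of $n$, $S^\lambda$ is the integral Specht module (the $\mathbb{Z}$-span of the polytabloids in the permutation module on $\lambda$-tabloids) and $S^\lambda_{\mathbb{Q}}=\mathbb{Q}\otimes_{\mathbb{Z}}S^\lambda$ is the Specht module over $\mathbb{Q}$. A full $\mathbb{Z}\mathcal{S}_n$-lattice in $S^\lambda_{\mathbb{Q}}$ is a $\mathbb{Z}\mathcal{S}_n$-submodule $X\subseteq S^\lambda_{\mathbb{Q}}$ that is finitely generated free over $\mathbb{Z}$ of rank $\dim_{\mathbb{Q}}S^\lambda_{\mathbb{Q}}$. Such a lattice is called unimodular if $X\cong X^*$ as $\mathbb{Z}\mathcal{S}_n$-modules, where $X^*=\mathrm{Hom}_{\mathbb{Z}}(X,\mathbb{Z})$ is the $\mathbb{Z}$-dual. *)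

(* Defs.v *)
From HB Require Import structures.
From mathcomp Require Import all_boot all_order all_algebra all_fingroup.

Set Implicit Arguments.
Unset Strict Implicit.
Unset Printing Implicit Defensive.

Import GRing.Theory.
Local Open Scope ring_scope.

(* In MathComp, (g * h) x = h (g x), so all the "g-actions" below satisfy
   x (g * h) = (x g) h and are right actions for this product, that is, left
   actions for the usual composition of permutations. *)

Section Tableaux.
Variables (n : nat) (la : seq nat).

(* The Young diagram of la: the cell (i, j), in row [tag] and column [tagged],
   with j < la_i. *)
Definition cell : finType := {i : 'I_(size la) & 'I_(nth 0%N la i)}.
Definition cell_row (c : cell) : 'I_(size la) := tag c.
Definition cell_col (c : cell) : nat := tagged c.

Definition is_tableau (t : {ffun cell -> 'I_n}) : bool :=
  injectiveb t && [forall x, x \in codom t].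

Record tableau := Tableau {
  tab_entry :> {ffun cell -> 'I_n};
  tab_entryP : is_tableau tab_entry }.
HB.instance Definition _ := [isSub for tab_entry].
HB.instance Definition _ := [Finite of tableau by <:].

Lemma tab_act_subproof (g : 'S_n) (t : tableau) :
  is_tableau [ffun c => g (t c)].
Proof.
case/andP: (tab_entryP t) => /injectiveP t_inj /forallP t_surj.
apply/andP; split.
  by apply/injectiveP => c d; rewrite !ffunE => /perm_inj /t_inj.
apply/forallP => x; have /codomP[c Dc] := t_surj (g^-1%g x).
by apply/codomP; exists c; rewrite ffunE -Dc permKV.
Qed.

Definition tab_act (g : 'S_n) (t : tableau) : tableau :=
  Tableau (tab_act_subproof g t).

(* The tabloid {t}: the tableau t up to the order of the entries in each row,
   i.e. the family of the sets of entries of the rows of t. *)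
Definition tab_rows (t : tableau) : {ffun 'I_(size la) -> {set 'I_n}} :=
  [ffun i => [set t c | c : cell & cell_row c == i]].

Record tabloid := Tabloid {
  tabloid_rows :> {ffun 'I_(size la) -> {set 'I_n}};
  tabloid_rowsP : [exists t : tableau, tabloid_rows == tab_rows t] }.
HB.instance Definition _ := [isSub for tabloid_rows].
HB.instance Definition _ := [Finite of tabloid by <:].

Lemma tabloid_of_subproof (t : tableau) :
  [exists s : tableau, tab_rows t == tab_rows s].
Proof. by apply/existsP; exists t. Qed.

Definition tabloid_of (t : tableau) : tabloid := Tabloid (tabloid_of_subproof t).

Lemma tabloid_act_subproof (g : 'S_n) (T : tabloid) :
  [exists t : tableau, [ffun i => g @: T i] == tab_rows t].
Proof.
have /existsP[t /eqP Tt] := tabloid_rowsP T.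
apply/existsP; exists (tab_act g t); apply/eqP/ffunP => i.
rewrite !ffunE Tt ffunE -imset_comp.
by apply: eq_imset => c /=; rewrite ffunE.
Qed.

Definition tabloid_act (g : 'S_n) (T : tabloid) : tabloid :=
  Tabloid (tabloid_act_subproof g T).

Lemma tabloid_act_of (g : 'S_n) (t : tableau) :
  tabloid_act g (tabloid_of t) = tabloid_of (tab_act g t).
Proof.
apply/val_inj/ffunP => i; rewrite /= !ffunE -imset_comp.
by apply: eq_imset => c /=; rewrite ffunE.
Qed.

Definition col_stab (t : tableau) : {set 'S_n} :=
  [set g : 'S_n | [forall c, forall d,
     (g (t c) == t d) ==> (cell_col c == cell_col d)]].

End Tableaux.

(* The permutation module on the tabloids, free over R on the [mod_basis T]. *)
Notation permmod n la R := {ffun tabloid n la -> R^o}.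

Section Specht.
Variables (n : nat) (la : seq nat).

Section PermModule.
Variable R : comNzRingType.
Local Notation permmod := (permmod n la R).

Definition mod_basis (T : tabloid n la) : permmod := [ffun U => (U == T)%:R].

Definition mod_act (g : 'S_n) (v : permmod) : permmod :=
  [ffun T => v (tabloid_act g^-1%g T)].

Lemma mod_act_basis (g : 'S_n) (T : tabloid n la) :
  mod_act g (mod_basis T) = mod_basis (tabloid_act g T).
Proof.
apply/ffunP => U; rewrite !ffunE; congr (_ %:R); congr nat_of_bool.
have actK (h k : 'S_n) (V : tabloid n la) : (h * k = 1)%g ->
    tabloid_act k (tabloid_act h V) = V.
  move=> hk1; apply/val_inj/ffunP => i; rewrite /= !ffunE -imset_comp.
  rewrite -[RHS]imset_id; apply: eq_imset => x /=.
  by rewrite -permM hk1 perm1.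
by apply/eqP/eqP => [<-|->]; rewrite actK ?mulVg ?mulgV.
Qed.

Definition polytabloid (t : tableau n la) : permmod :=
  \sum_(g in col_stab t) (-1) ^+ odd_perm g *: mod_basis (tabloid_of (tab_act g t)).

End PermModule.

Definition specht_int (u : permmod n la int) : Prop :=
  exists a : {ffun tableau n la -> int}, u = \sum_t a t *: polytabloid int t.

(* The module obtained from specht_int by extension of scalars, realised inside
   the rational permutation module; see mem_specht_rat. *)
Definition specht_rat : {vspace permmod n la rat} :=
  <<[seq polytabloid rat t | t : tableau n la]>>%VS.

Lemma polytabloid_ratE (t : tableau n la) T :
  polytabloid rat t T = (polytabloid int t T)%:~R.
Proof.
rewrite /polytabloid !sum_ffunE rmorph_sum; apply: eq_bigr => g _.
by rewrite !ffunE /GRing.scale /= rmorphM rmorphXn rmorphN1 rmorph_nat.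
Qed.

Lemma mem_specht_rat (v : permmod n la rat) :
  v \in specht_rat <->
  exists k : int, k != 0 /\
    exists u, specht_int u /\ forall T, k%:~R * v T = (u T)%:~R.
Proof.
rewrite /specht_rat span_def big_image /=; split.
  case/memv_sumP=> w w_in ->.
  have /fin_all_exists[a Da] t : exists c, w t = c *: polytabloid rat t.
    by have /vlineP[c ->] := w_in t isT; exists c.
  pose k := \prod_t denq (a t).
  exists k; split; first by apply/prodf_neq0 => t _; apply: denq_neq0.
  pose b := [ffun t => numq (a t) * \prod_(s | s != t) denq (a s)].
  exists (\sum_t b t *: polytabloid int t); split; first by exists b.
  move=> T; rewrite !sum_ffunE mulr_sumr rmorph_sum; apply: eq_bigr => t _.
  rewrite Da !ffunE /GRing.scale /= polytabloid_ratE mulrA !rmorphM /=.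
  congr (_ * _); rewrite /k (bigD1 t) //= rmorphM /= mulrAC; congr (_ * _).
  by rewrite numqE mulrC.
case=> k [k0 [_ [[a ->] Dv]]].
have k0Q : k%:~R != 0 :> rat by rewrite intr_eq0.
suff -> : v = \sum_t ((a t)%:~R / k%:~R) *: polytabloid rat t.
  apply: memv_sumr => t _.
  by apply: memvZ; apply: memv_line.
apply/ffunP => T; apply: (mulfI k0Q); rewrite Dv !sum_ffunE mulr_sumr rmorph_sum.
apply: eq_bigr => t _; rewrite !ffunE /GRing.scale /= polytabloid_ratE rmorphM /=.
by rewrite mulrA mulrCA mulfV // mulr1.
Qed.

End Specht.

(* [sub_elt X] is the additive subgroup X of V as a Z-module in its own right.
   Membership in X is boolean; this loses no lattice, as membership in a finitely
   generated subgroup of a finite-dimensional rational space is decidable. *)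
Section Lattices.

Record sub_elt (V : zmodType) (X : zmodClosed V) := SubElt {
  sub_val :> V;
  sub_valP : sub_val \in X }.
HB.instance Definition _ V X := [isSub for @sub_val V X].
HB.instance Definition _ V X := [Choice of @sub_elt V X by <:].
HB.instance Definition _ V X := [SubChoice_isSubZmodule of @sub_elt V X by <:].

Definition Zfree_of_rank (A : zmodType) (d : nat) : Prop :=
  exists b : 'I_d -> A, forall x : A,
    exists! a : {ffun 'I_d -> int}, x = \sum_i b i *~ a i.

Variables (n : nat) (la : seq nat).

Record full_lattice (U : {vspace permmod n la rat}) := FullLattice {
  lat_set :> zmodClosed (permmod n la rat);
  lat_sub : {subset lat_set <= U};
  lat_stable : forall (g : 'S_n) v, v \in lat_set -> mod_act g v \in lat_set;
  lat_free : Zfree_of_rank (sub_elt lat_set) (\dim U) }.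

Variables (U : {vspace permmod n la rat}) (X : full_lattice U).

Definition lat_act (g : 'S_n) (x : sub_elt X) : sub_elt X :=
  SubElt (lat_stable g (sub_valP x)).

(* phi is an isomorphism of X onto X^* = Hom_Z(X, Z), the action of g on X^*
   being (f g)(y) = f (y g^-1). *)
Definition dual_iso (phi : sub_elt X -> {additive sub_elt X -> int}) : Prop :=
  [/\ forall x y z, phi (x + y) z = phi x z + phi y z,
      forall g x y, phi (lat_act g x) y = phi x (lat_act g^-1%g y),
      forall x y, phi x =1 phi y -> x = y &
      forall f : {additive sub_elt X -> int}, exists x, phi x =1 f].

Definition unimodular : Prop := exists phi, dual_iso phi.

End Lattices.

(* Main.v *)
(* Suppose X is unimodular. The Specht module is absolutely irreducible, so the form
   on X is c <.,.> for a rational c, where <.,.> is the standard form on functions on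
   m-subsets; there the Specht module is the kernel of the lowering map. The product
   of (1 - transposition) over m - k disjoint pairs is an idempotent up to a power
   of 2, so its image in X is unimodular up to powers of 2; this image spans the
   kernel of the lowering map of the rank-k level of a Boolean lattice on
   n - 2(m - k) points. The discriminant of that kernel is, up to squares, det(U U^T)
   for the inclusion matrix U of level k - 1 in level k, and the commutation relation
   of the inclusion matrices evaluates it inductively. For k = 0 this gives that c, and
   for k = 1, 2, 3 that N + 1, 2 (N + 2) and 3 (N + 3), where N = n - 2m + 1, lie in
   the group generated by -1, 2 and the rational squares. Elementary congruences reduce
   this to x^2 + 1 = 2 y^2, x^2 + 2 = 3 z^2, whose only solution x = 1 gives N = 0. *)
Require Import Defs.
From HB Require Import structures.
From mathcomp Require Import all_boot all_order all_algebra all_fingroup.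
From mathcomp Require Import zify ring lra.

Set Implicit Arguments.
Unset Strict Implicit.
Unset Printing Implicit Defensive.

Import Order.TTheory GRing.Theory Num.Theory.

(** * A Diophantine system *)

Section NumberTheory.
Local Open Scope nat_scope.

(** Square classes are the right invariant because X is arbitrary: its Gram matrices and those of
    the explicit kernel are related only by an unknown rational change of basis, whose determinant
    enters squared. The factor 2 is unavoidable since (1 - tau)^2 = 2 (1 - tau) for a transposition
    tau, and the sign since c may be negative. Irreducibility enters through lines. For m disjoint
    pairs, the functions on m-subsets that change sign under each pair swap form a line, spanned by
    a polytabloid, and every nonzero function killed by the lowering map has nonzero inner product
    with one of these lines. Two invariant forms are proportional along each line, with a common
    factor because S_n permutes the lines transitively; the same detection shows that X spans the
    whole kernel. The bound m >= 3 makes k = 3 available: from k <= 2 alone, the Pell equation x^2 +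
    1 = 2 y^2 leaves infinitely many N. *)

Lemma sqr_mul_coprime (a b c : nat) :
  coprime a b -> a * b = c ^ 2 -> exists u, a = u ^ 2.
Proof.
move=> co ab; have [->|a0] := posnP a; first by exists 0.
have g0 : 0 < gcdn a c by rewrite gcdn_gt0 a0.
have [a' Da] := dvdnP (dvdn_gcdl a c); have [c' Dc] := dvdnP (dvdn_gcdr a c).
move: Da Dc g0 (erefl (gcdn a c)); move: {1 2 3 4}(gcdn a c) => g Da Dc g0 Dg.
have co' : coprime a' c'.
  rewrite /coprime -(eqn_pmul2r g0) muln_gcdl -Da -Dc Dg mul1n eqxx //.
have e1 : a' * b = g * c' ^ 2 by nia.
have : a' %| g by rewrite -(@Gauss_dvdl _ _ (c' ^ 2)) ?coprimeXr // -e1 dvdn_mulr.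
case/dvdnP=> h Dh; have a'0 : 0 < a' by case: (a') Da a0 => // ->.
have e2 : b = h * c' ^ 2 by nia.
have /eqP h1 : h == 1.
  rewrite -dvdn1 -(eqP co) dvdn_gcd Da {1}Dh e2 (dvdn_mulr _ (dvdnn h)) andbT.
  by rewrite mulnCA dvdn_mulr.
by exists g; rewrite Da; nia.
Qed.

Lemma sqr_of_mul_sqr (x d u : nat) : 0 < d -> x * d ^ 2 = u ^ 2 -> exists v, x = v ^ 2.
Proof.
move=> d0 e; have : d ^ 2 %| u ^ 2 by rewrite -e dvdn_mull.
by rewrite dvdn_pexp2r // => /dvdnP[v Du]; exists v; nia.
Qed.

Lemma dvd_sqr_prime p u : prime p -> p %| u ^ 2 -> exists v, u = p * v.
Proof. by move=> pp; rewrite Euclid_dvdX // andbT => /dvdnP[v ->]; exists v; rewrite mulnC. Qed.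

(** The value lies strictly between the squares of 2k and 2k + 1. *)
Lemma pronic_nsqr (k u : nat) : 0 < k -> 4 * k * (k + 1) != u ^ 2.
Proof.
move=> k0; apply/eqP => Du.
have lu : 2 * k < u by rewrite -ltn_sqr -Du; clear Du; nia.
have : u < 2 * k + 1 by rewrite -ltn_sqr -Du; clear Du; nia.
by lia.
Qed.

Lemma quartic_eq1 (e w : nat) : e ^ 4 = 2 * w ^ 2 + 1 -> e = 1.
Proof.
move=> h.
have oe : odd e by have := congr1 odd h; rewrite oddD oddM oddX /=.
have [k Dk] : exists k, e = 2 * k + 1 by exists e./2; rewrite -{1}(odd_double_half e) oe; lia.
have [k0|k0] := posnP k; first by rewrite Dk k0.
(* (e^2 - 1) ((e^2 + 1) / 2) = w^2 with coprime factors *)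
pose a := 4 * k * (k + 1); pose b := 2 * k * (k + 1) + 1.
have ab : a * b = w ^ 2 by rewrite /a /b; nia.
have co : coprime a b.
  have -> : a = 2 * (b - 1) by rewrite /a /b; lia.
  rewrite coprimeMl coprime2n; apply/andP; split.
    by rewrite /b oddD !oddM.
  by rewrite {2}(_ : b = (b - 1).+1) ?coprimenS // /b; lia.
have [u Du] := sqr_mul_coprime co ab.
by case/eqP: (pronic_nsqr u k0).
Qed.

(** Up to sign 2x is p - q, so eight times the first equation reads 2 (p - q)^2 + 8 = (p + q)^2. *)
Lemma pell_quartic (x y p q : nat) : x ^ 2 + 1 = 2 * y ^ 2 -> 4 * y = p + q ->
  p = 2 * x + q \/ q = 2 * x + p -> p ^ 2 + q ^ 2 + 8 = 6 * p * q.
Proof.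
move=> h e [] E; rewrite E in e *.
  have e2 : 2 * y = x + q by lia.
  by have := congr1 (expn^~ 2) e2; rewrite /= expnMn; clear e e2 E; nia.
have e2 : 2 * y = x + p by lia.
by have := congr1 (expn^~ 2) e2; rewrite /= expnMn; clear e e2 E; nia.
Qed.

(* The second hypothesis reads 9 (f^2 - e^2)^2 = 8 (e^4 - 1). *)
Lemma quartic_eq (e f t : nat) : e = f + 2 * t \/ f = e + 2 * t ->
  (e ^ 2) ^ 2 + (3 * f ^ 2) ^ 2 + 8 = 6 * e ^ 2 * (3 * f ^ 2) ->
  exists w, e ^ 4 = 2 * w ^ 2 + 1.
Proof.
case=> -> h; [exists (3 * t * (t + f)) | exists (3 * t * (t + e))]; lia.
Qed.

Lemma same_parity (e f : nat) :
  odd e = odd f -> exists t, e = f + 2 * t \/ f = e + 2 * t.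
Proof.
move=> oef; case: (leqP e f) => [|/ltnW] le.
  exists (f - e)./2; right; have := odd_double_half (f - e).
  by rewrite oddB // oef addbb; lia.
exists (e - f)./2; left; have := odd_double_half (e - f).
by rewrite oddB // oef addbb; lia.
Qed.

(** The two equations give (2y + x)(2y - x) = x^2 + 2 = 3 z^2 with odd coprime factors, so one
    factor is a square e^2 and the other 3 f^2. Substituted in the first equation, this is the
    quartic that forces e = 1. *)
Lemma pell_pair (x y z : nat) :
  x ^ 2 + 1 = 2 * y ^ 2 -> x ^ 2 + 2 = 3 * z ^ 2 -> x = 1.
Proof.
move=> hy hz.
have lexy : x < 2 * y by nia.
pose p := 2 * y + x; pose q := 2 * y - x.
have pq : p * q = 3 * z ^ 2 by rewrite /p /q; nia.
have ox : odd x.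
  have : odd (x ^ 2 + 1) = false by rewrite hy oddM.
  by rewrite oddD oddX /= addbT => /negbFE.
have x0 : 0 < x by case: (x) ox.
have co : coprime p q.
  have op : odd p by rewrite /p oddD oddM ox.
  have : gcdn p q %| gcdn (4 * y) (2 * x).
    have -> : 4 * y = p + q by rewrite /p /q; lia.
    have -> : 2 * x = p - q by rewrite /p /q; lia.
    rewrite dvdn_gcd; apply/andP; split.
      by apply: dvdn_add; rewrite ?dvdn_gcdl ?dvdn_gcdr.
    by apply: dvdn_sub; rewrite ?dvdn_gcdl ?dvdn_gcdr.
  have -> : 4 * y = 2 * (2 * y) by lia.
  rewrite -muln_gcdr.
  have co2 : coprime (gcdn p q) 2.
    by rewrite coprime_sym; apply: (coprime_dvdr (dvdn_gcdl p q)); rewrite coprime2n.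
  rewrite Gauss_dvdr // => h.
  have gxy : gcdn x y = 1.
    apply/eqP; rewrite -dvdn1; have -> : 1 = 2 * y ^ 2 - x ^ 2 by lia.
    rewrite -!mulnn; apply: dvdn_sub; last by rewrite dvdn_mulr ?dvdn_gcdl.
    by rewrite !dvdn_mull ?dvdn_gcdr.
  by move: h; rewrite [gcdn _ x]gcdnC Gauss_gcdr ?coprimen2 // gxy dvdn1.
(* Subtraction truncates here: for e = f = 1 one alternative reads 2x = 0, which [x0] excludes. *)
have main (e f : nat) : 4 * y = e ^ 2 + 3 * f ^ 2 ->
    2 * x = e ^ 2 - 3 * f ^ 2 \/ 2 * x = 3 * f ^ 2 - e ^ 2 -> x = 1.
  move=> Dy Dx.
  have oef : odd e = odd f.
    by have := congr1 odd Dy; rewrite !(oddX, oddM, oddD) /=; case: (odd e); case: (odd f).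
  have quartic : (e ^ 2) ^ 2 + (3 * f ^ 2) ^ 2 + 8 = 6 * e ^ 2 * (3 * f ^ 2).
    by apply: (pell_quartic hy Dy); case: Dx => Dx; [left | right]; clear -Dx x0; lia.
  have [t Dt] := same_parity oef.
  have [w /quartic_eq1 e1] := quartic_eq Dt quartic.
  have f1 : f = 1 by rewrite e1 in quartic; clear - quartic; nia.
  by rewrite e1 f1 in Dx Dy; clear -Dx x0; lia.
have : 3 %| p * q by rewrite pq dvdn_mulr.
have pqE : p + q = 4 * y /\ p - q = 2 * x by rewrite /p /q; split; lia.
rewrite Euclid_dvdM // => /orP[] /dvdnP[r Dr].
- have co' : coprime r q by apply: coprime_dvdl co; rewrite Dr dvdn_mulr.
  have e : r * q = z ^ 2 by rewrite Dr in pq; clear -pq; lia.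
  have [f Df] := sqr_mul_coprime co' e.
  rewrite coprime_sym in co'; rewrite mulnC in e.
  have [g Dg] := sqr_mul_coprime co' e.
  by apply: (main g f); rewrite -Df -Dg; clear -pqE Dr; lia.
have co' : coprime p r by apply: coprime_dvdr co; rewrite Dr dvdn_mulr.
have e : p * r = z ^ 2 by rewrite Dr in pq; clear -pq; lia.
have [g Dg] := sqr_mul_coprime co' e.
rewrite coprime_sym in co'; rewrite mulnC in e.
have [f Df] := sqr_mul_coprime co' e.
by apply: (main g f); rewrite -Df -Dg; clear -pqE Dr; lia.
Qed.

Lemma consecutive_sqr (x y : nat) : 0 < x -> x ^ 2 + 1 <> y ^ 2.
Proof.
move=> x0 e.
have : x < y by rewrite -ltn_sqr -e addn1.
have : y < x + 1 by rewrite -ltn_sqr -e; clear e; nia.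
by lia.
Qed.

(** -1 is not a square modulo 3. *)
Lemma sqr_succ_mod3 (y w : nat) : y ^ 2 + 1 <> 3 * w.
Proof.
rewrite (divn_eq y 3); move: (y %/ 3) (y %% 3) (ltn_pmod y (isT : 0 < 3)).
by move=> q [|[|[|r]]] //= _ e; lia.
Qed.

(** Extracting factors 2 and 3 makes N + 1 equal to x^2 or 2 x^2, N + 2 to y^2 or 2 y^2, and N + 3
    to 3 z^2 or 6 z^2. Parity, consecutive squares and reduction modulo 3 exclude every combination
    except x^2, 2 y^2, 3 z^2, which is left to [pell_pair]. *)
Lemma no_square_triple (N : nat) : 0 < N ->
  (exists u, N.+1 = u ^ 2 \/ 2 * N.+1 = u ^ 2) ->
  (exists u, 2 * N.+2 = u ^ 2 \/ 2 * (2 * N.+2) = u ^ 2) ->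
  (exists u, 3 * N.+3 = u ^ 2 \/ 2 * (3 * N.+3) = u ^ 2) -> False.
Proof.
move=> N0 [x hx] [y hy] [z hz].
have [z' hz'] : exists z', N.+3 = 3 * z' ^ 2 \/ N.+3 = 6 * z' ^ 2.
  case: hz => hz.
    have [|v Dv] := @dvd_sqr_prime 3 z isT; first by rewrite -hz dvdn_mulr.
    by exists v; left; nia.
  have [|v Dv] := @dvd_sqr_prime 3 z isT; first by rewrite -hz mulnCA dvdn_mulr.
  have [|w Dw] := @dvd_sqr_prime 2 v isT.
    rewrite -(@Gauss_dvdr _ 3) //; have -> : 3 * v ^ 2 = 2 * N.+3 by nia.
    by rewrite dvdn_mulr.
  by exists w; right; nia.
have [y' hy'] : exists y', N.+2 = 2 * y' ^ 2 \/ N.+2 = y' ^ 2.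
  have [|v Dv] := @dvd_sqr_prime 2 y isT; first by case: hy => <-; rewrite dvdn_mulr.
  by exists v; rewrite Dv in hy; clear -hy; lia.
have [x' hx'] : exists x', N.+1 = x' ^ 2 \/ N.+1 = 2 * x' ^ 2.
  case: hx => hx; first by exists x; left.
  have [|v Dv] := @dvd_sqr_prime 2 x isT; first by rewrite -hx dvdn_mulr.
  by exists v; right; rewrite Dv in hx; clear -hx; lia.
clear hx hy hz; case: hx' hy' => hx' [] hy'.
- case: hz' => hz'; last by clear -hy' hz'; lia.
  suff e : x' = 1 by rewrite e in hx'; clear -N0 hx'; lia.
  by apply: (@pell_pair x' y' z'); clear -hx' hy' hz'; lia.
- apply: (@consecutive_sqr x' y'); first by case: (x') hx'.
  by clear -hx' hy'; lia.
- by clear -hx' hy'; lia.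
case: hz' => hz'.
  by apply: (@sqr_succ_mod3 y' (z' ^ 2)); clear -hy' hz'; lia.
by apply: (@sqr_succ_mod3 y' (2 * z' ^ 2)); clear -hy' hz'; lia.
Qed.
End NumberTheory.

(** * Square classes and determinants *)

Section SquareClasses.
Local Open Scope ring_scope.

(** Exponents are arbitrary naturals rather than bits, so that products need no parity cases. *)
Definition sqclass_pm2 (x : rat) : Prop :=
  exists e b (q : rat), q != 0 /\ x = (-1) ^+ e * 2%:R ^+ b * q ^+ 2.

Lemma sqclass_pm2_neq0 x : sqclass_pm2 x -> x != 0.
Proof.
case=> e [b [q [q0 ->]]].
by rewrite !mulf_neq0 ?expf_neq0 // oppr_eq0 oner_eq0.
Qed.

Lemma sqclass_pm2_sqr x : x != 0 -> sqclass_pm2 (x ^+ 2).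
Proof. by move=> x0; exists 0%N, 0%N, x; rewrite !expr0 !mul1r. Qed.

Lemma sqclass_pm2_signed_pow2 e b : sqclass_pm2 ((-1) ^+ e * 2%:R ^+ b).
Proof. by exists e, b, 1; rewrite oner_neq0 expr1n mulr1. Qed.

Lemma sqclass_pm2M x y : sqclass_pm2 x -> sqclass_pm2 y -> sqclass_pm2 (x * y).
Proof.
case=> e [b [q [q0 ->]]] [e' [b' [q' [q0' ->]]]].
exists (e + e')%N, (b + b')%N, (q * q'); split; first by rewrite mulf_neq0.
by rewrite !exprD !exprMn; ring.
Qed.

Lemma sqclass_pm2X x n : sqclass_pm2 x -> sqclass_pm2 (x ^+ n).
Proof.
move=> Tx; elim: n => [|n IH]; last by rewrite exprS; apply: sqclass_pm2M.
by rewrite expr0 -(expr1n _ 2); apply: sqclass_pm2_sqr; rewrite oner_neq0.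
Qed.

Lemma sqclass_pm2_cancel x y : sqclass_pm2 x -> sqclass_pm2 (x * y) -> sqclass_pm2 y.
Proof.
move=> Tx Txy; have x0 := sqclass_pm2_neq0 Tx.
have -> : y = x * y * (x * (x^-1) ^+ 2) by field.
apply: (sqclass_pm2M Txy); apply: (sqclass_pm2M Tx).
by apply: sqclass_pm2_sqr; rewrite invr_eq0.
Qed.

Lemma sqclass_pm2_nat (k : nat) :
  sqclass_pm2 k%:R -> exists u, (k = u ^ 2)%N \/ (2 * k = u ^ 2)%N.
Proof.
case=> e [b [q [q0 Dk]]].
pose d := `|denq q|%N; pose u := `|numq q|%N.
have d0 : (0 < d)%N by rewrite absz_gt0 denq_neq0.
have : (k * d ^ 2 = 2 ^ b * u ^ 2)%N.
  apply/eqP; rewrite -(eqr_nat rat) !natrM !natrX.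
  have Dd : d%:R = (denq q)%:~R :> rat by rewrite -[in RHS]absz_denq.
  have Du : u%:R ^+ 2 = (numq q)%:~R ^+ 2 :> rat.
    by rewrite -[u%:R]/((u : int)%:~R) /u abszE intr_norm real_normK ?num_real.
  have qd : (denq q)%:~R != 0 :> rat by rewrite intr_eq0 denq_neq0.
  have : (k%:R * d%:R ^+ 2) = (-1) ^+ e * (2%:R ^+ b * u%:R ^+ 2) :> rat.
    by rewrite Dk Dd Du -{1}(divq_num_den q); field.
  move/(congr1 Num.norm); by rewrite !normrM !normrX normrN1 expr1n mul1r !normr_nat => ->.
rewrite -{1}(odd_double_half b) -muln2 expnD expnM => h.
case: (odd b) h => h.
  have [//|v Dv] := @sqr_of_mul_sqr (2 * k) d (2 * (2 ^ b./2 * u)) d0; last by exists v; right.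
  by rewrite !expnMn -mulnA h expn1; ring.
have [//|v Dv] := @sqr_of_mul_sqr k d (2 ^ b./2 * u) d0; last by exists v; left.
by rewrite expnMn h mul1n.
Qed.

End SquareClasses.

(** * Determinant identities and quasi-idempotent integer matrices *)

Section Matrices.
Local Open Scope ring_scope.

(** Sylvester's determinant identity, multiplied out so that a need not be invertible: [M] has
    determinant det(a + AB), and its product with a block triangular matrix of determinant a^q has
    determinant a^p det(a + BA). *)
Lemma det_scalar_add_mulmxC (F : comNzRingType) p q (A : 'M[F]_(p, q)) (B : 'M_(q, p)) a :
  a ^+ q * \det (a%:M + A *m B) = a ^+ p * \det (a%:M + B *m A).
Proof.
pose M := block_mx a%:M A (- B) 1%:M.
have e1 : M *m block_mx 1%:M 0 B 1%:M = block_mx (a%:M + A *m B) A 0 1%:M.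
  by rewrite mulmx_block !(mulmx1, mul1mx, mulmx0, add0r, addNr).
have e2 : block_mx 1%:M 0 B a%:M *m M = block_mx a%:M A 0 (a%:M + B *m A).
  rewrite mulmx_block !(mulmx1, mul1mx, mul0mx, addr0, mulmxN).
  by rewrite mul_mx_scalar mul_scalar_mx subrr [B *m A + _]addrC.
have := congr1 determinant e1; rewrite det_mulmx !(det_lblock, det_ublock) !det1 !mulr1 => <-.
by have := congr1 determinant e2; rewrite det_mulmx !(det_lblock, det_ublock) !det1 mul1r !det_scalar.
Qed.

(** The Gram matrix of the square matrix stacking Z on W is block diagonal, so orthogonal
    complements have the same discriminant up to squares. *)
Lemma det_gram_complement (F : comNzRingType) r p q (Z : 'M[F]_(r, q)) (W : 'M_(p, q)) :
  (r + p = q)%N -> Z *m W^T = 0 ->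
  exists s, s ^+ 2 = \det (Z *m Z^T) * \det (W *m W^T).
Proof.
move=> e; case: q / e in Z W * => ZW.
exists (\det (col_mx Z W)); rewrite expr2 -{2}det_tr -det_mulmx.
rewrite tr_col_mx mul_col_row ZW.
have -> : W *m Z^T = 0 by rewrite -[LHS]trmxK trmx_mul trmxK ZW trmx0.
by rewrite det_ublock.
Qed.

(* The row module of a quasi-idempotent E is a direct summand of Z^d,
   with basis the rows of P. *)
Lemma quasi_idempotent_factor d (E : 'M[int]_d) (t : int) :
  E *m E = t *: E ->
  exists r (P : 'M[int]_(r, d)) (S L : 'M[int]_(d, r)),
    [/\ P *m S = 1%:M, E = L *m P & P *m L = t%:M].
Proof.
move=> EE; have [L uL [R uR [s _ DE]]] := int_Smith_normal_form E.
set D : 'M[int]_d := \matrix_(i, j) _ in DE.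
(* Positions past the end of [s] read the default 0 and are discarded with the zero invariant
   factors. *)
pose I := [set i : 'I_d | s`_i != 0].
pose f (i : 'I_#|I|) := enum_val i.
have f_inj : injective f by apply: enum_val_inj.
pose P := rowsub f R; pose S := colsub f (invmx R).
pose L1 := colsub f (L *m D); pose L2 := rowsub f (invmx L).
exists #|I|, P, S, L1.
have sumI (M : nmodType) (F : 'I_d -> M) :
    (forall i, i \notin I -> F i = 0) -> \sum_i F i = \sum_(i < #|I|) F (f i).
  move=> F0; rewrite (bigID (mem I)) /= [X in _ + X]big1 ?addr0; last by move=> i /F0.
  by rewrite big_enum_val.
have LD i j : (L *m D) i j = L i j * s`_j.
  rewrite mxE (bigD1 j) //= big1 ?addr0 ?mxE ?eqxx ?mulr1n // => k kj.
  by rewrite mxE (negPf (_ : k != j :> nat)) ?mulr0 // -val_eqE.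
have PS : P *m S = 1%:M.
  apply/matrixP => i j; transitivity ((R *m invmx R) (f i) (f j)).
    by rewrite !mxE; apply: eq_bigr => k _; rewrite !mxE.
  by rewrite mulmxV // !mxE (inj_eq f_inj).
have EL : E = L1 *m P.
  apply/matrixP => i j; rewrite DE !mxE sumI.
    by apply: eq_bigr => k _; rewrite [in RHS]mxE [P _ _]mxE.
  by move=> k; rewrite inE negbK LD => /eqP->; rewrite mulr0 mul0r.
split=> //.
(* [L2] inverts [L1] from the left up to nonzero diagonal entries; this cancels [L1] in L1 (P L1) =
   L1 t. *)
have L12 i (M : 'M_(#|I|)) j : (L2 *m (L1 *m M)) i j = s`_(f i) * M i j.
  have L21 k : (L2 *m L1) i k = s`_(f i) *+ (i == k).
    transitivity ((invmx L *m (L *m D)) (f i) (f k)).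
      by rewrite !mxE; apply: eq_bigr => l _; rewrite !mxE.
    by rewrite mulKmx // mxE val_eqE (inj_eq f_inj).
  rewrite mulmxA mxE (bigD1 i) //= big1 => [|k ki].
    by rewrite addr0 L21 eqxx.
  by rewrite L21 eq_sym (negPf ki) mul0r.
apply/matrixP => i j.
have : L1 *m (P *m L1) = L1 *m t%:M.
  have := EE; rewrite EL mulmxA -(mulmxA L1) scalemxAl => /(congr1 (mulmx^~ S)).
  by rewrite /= -!(mulmxA _ P S) PS !mulmx1 mul_mx_scalar.
move/(congr1 (fun M => (L2 *m M) i j)); rewrite !L12; apply: mulfI.
by have := enum_valP i; rewrite inE.
Qed.

End Matrices.

(** * Inclusion matrices of an interval of sets *)

Section Interval.
Local Open Scope ring_scope.
Variables (T : finType) (A B : {set T}).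

(** The index is shifted: level i holds the sets of rank i - 1 in the interval from A to B. Level 0
    is thus empty, and [incidence k] is the inclusion matrix of rank k - 1 in rank k even for k =
    0. *)
Definition level i :=
  [set C : {set T} | [&& A \subset C, C \subset B & #|C|.+1 == #|A| + i]%N].

Definition incidence i : 'M[rat]_(#|level i|, #|level i.+1|) :=
  \matrix_(x < #|level i|, y < #|level i.+1|) (enum_val x \subset enum_val y)%:R.

Lemma card_level0 : #|level 0| = 0%N.
Proof.
apply: eq_card0 => C; rewrite !inE; apply/and3P => -[/subset_leq_card].
by rewrite addn0 => le _ /eqP e; lia.
Qed.

Hypothesis sAB : A \subset B.

Lemma level1 : level 1 = [set A].
Proof.
apply/setP => C; rewrite !inE; apply/and3P/eqP => [[sAC _]|->].
  by rewrite addn1 eqSS => /eqP e; apply/esym/eqP; rewrite eqEcard sAC e leqnn.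
by rewrite addn1 eqxx.
Qed.

Lemma level_above i X : X \in level i ->
  [set Z in level i.+1 | X \subset Z] = (fun z => z |: X) @: (B :\: X).
Proof.
rewrite inE => /and3P[sAX sXB /eqP cX].
apply/setP => Z; rewrite !inE; apply/andP/imsetP.
  case=> /and3P[sAZ sZB /eqP cZ] sXZ.
  have /cards1P[z Dz] : #|Z :\: X| == 1%N by rewrite cardsDS //; lia.
  have zZX : z \in Z :\: X by rewrite Dz set11.
  exists z; first by move: zZX; rewrite !inE => /andP[-> /(subsetP sZB)].
  by rewrite -Dz setDE setUIl setUC (setUidPr sXZ) setUC setUCr setIT.
case=> z; rewrite !inE => /andP[zX zB] ->.
rewrite cardsU1 zX subsetUr (subset_trans sAX) ?subsetUr // subUset sub1set zB sXB.
by split=> //; apply/eqP; lia.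
Qed.

Lemma setU1_inj (X : {set T}) : {in ~: X &, injective (fun z => z |: X)}.
Proof.
move=> x y; rewrite !inE => xX yX e.
by have := setU11 x X; rewrite e !inE (negPf xX) orbF => /eqP.
Qed.

Lemma card_level_above i X : X \in level i ->
  #|[set Z in level i.+1 | X \subset Z]| = (#|B| - #|X|)%N.
Proof.
move=> LX; rewrite level_above // card_in_imset ?cardsDS //.
  by move: LX; rewrite inE => /and3P[].
by move=> x y; rewrite !inE => /andP[xX _] /andP[yX _]; apply: setU1_inj; rewrite inE.
Qed.

Lemma card_level_below i X : X \in level i.+1 ->
  #|[set W in level i | W \subset X]| = i.
Proof.
rewrite inE => /and3P[sAX sXB /eqP cX].
have -> : [set W in level i | W \subset X] = (fun z => X :\ z) @: (X :\: A).
  apply/setP => W; rewrite !inE; apply/andP/imsetP.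
    case=> /and3P[sAW sWB /eqP cW] sWX.
    have /cards1P[z Dz] : #|X :\: W| == 1%N by rewrite cardsDS //; lia.
    have : z \in X :\: W by rewrite Dz set11.
    rewrite inE => /andP[zW zX].
    exists z; first by rewrite inE zX andbT; apply: contra zW => /(subsetP sAW).
    by rewrite -Dz setDDr setDv set0U; apply/esym/setIidPr.
  case=> z; rewrite !inE => /andP[zA zX] ->.
  rewrite subsetD1 sAX zA subsetDl (subset_trans (subsetDl _ _) sXB).
  by split=> //; have := cardsD1 z X; rewrite zX; lia.
rewrite card_in_imset ?cardsDS //; first lia.
move=> x y; rewrite !inE => /andP[_ xX] /andP[_ yX] e.
have : x \notin X :\ y by rewrite -e !inE eqxx.
by rewrite !inE xX andbT negbK => /eqP.
Qed.

(** The only candidates are the union of X and Y above and their intersection below. Both have the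
    required size exactly when the union has |X| + 1 elements, so the counts are both 1 or both
    0. *)
Lemma card_level_between i X Y : X \in level i.+1 -> Y \in level i.+1 -> X != Y ->
  #|[set Z in level i.+2 | (X \subset Z) && (Y \subset Z)]|
  = #|[set W in level i | (W \subset X) && (W \subset Y)]|.
Proof.
rewrite !inE => /and3P[sAX sXB /eqP cX] /and3P[sAY sYB /eqP cY] XY.
have lt : (#|X| < #|X :|: Y|)%N.
  rewrite proper_card // properEneq subsetUl andbT eq_sym; apply: contra XY => /eqP e.
  by rewrite eq_sym eqEcard; apply/andP; split; [apply/setUidPl | lia].
have cUI := cardsUI X Y.
transitivity (#|X :|: Y| == #|X|.+1 : nat); last first.
  have -> : [set W in level i | (W \subset X) && (W \subset Y)] =
      if #|X :|: Y| == #|X|.+1 then [set X :&: Y] else set0.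
    case: ifP => [/eqP|] cU; apply/setP => W; rewrite !inE -subsetI.
      apply/andP/eqP => [[/and3P[_ _ /eqP cW] sW] | ->].
        by apply/eqP; rewrite eqEcard sW; lia.
      rewrite subxx subsetI sAX sAY (subset_trans (subsetIl _ _) sXB).
      by split=> //; apply/eqP; lia.
    apply/andP => -[/and3P[_ _ /eqP cW] /subset_leq_card le].
    by move/eqP: cU; lia.
  by case: ifP; rewrite ?cards1 ?cards0.
have -> : [set Z in level i.+2 | (X \subset Z) && (Y \subset Z)] =
    if #|X :|: Y| == #|X|.+1 then [set X :|: Y] else set0.
  case: ifP => [/eqP|] cU; apply/setP => Z; rewrite !inE -subUset.
    apply/andP/eqP => [[/and3P[_ _ /eqP cZ] sZ] | ->].
      by apply/esym/eqP; rewrite eqEcard sZ; lia.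
    rewrite subxx (subset_trans sAX (subsetUl _ _)) subUset sXB sYB.
    by split=> //; apply/eqP; lia.
  apply/andP => -[/and3P[_ _ /eqP cZ] /subset_leq_card le].
  by move/eqP: cU; lia.
by case: ifP; rewrite ?cards1 ?cards0.
Qed.

Lemma sum_level_card i (P : pred {set T}) :
  \sum_(z < #|level i|) (P (enum_val z))%:R = #|[set Z in level i | P Z]|%:R :> rat.
Proof.
rewrite -(big_enum_val (fun Z => (P Z)%:R)) -sum1_card natr_sum.
rewrite [RHS](eq_bigl (fun Z => (Z \in level i) && P Z)); last by move=> Z; rewrite !inE.
by rewrite [RHS]big_mkcondr; apply: eq_bigr => Z _; case: (P Z).
Qed.

(** The sl_2 relation of a Boolean lattice. Off the diagonal the two counts agree by
    [card_level_between]; on it, a set of rank i has n - i sets just above it and i just below. *)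
Lemma incidence_comm n i : (#|B| = #|A| + n)%N ->
  incidence i.+1 *m (incidence i.+1)^T
  = (n%:R - (2 * i)%:R)%:M + (incidence i)^T *m incidence i.
Proof.
move=> cB; apply/matrixP => x y; rewrite !mxE.
have Lx := enum_valP x; have Ly := enum_valP y.
transitivity (#|[set Z in level i.+2 | (enum_val x \subset Z) && (enum_val y \subset Z)]|%:R : rat).
  by rewrite -sum_level_card; apply: eq_bigr => z _; rewrite !mxE -natrM mulnb.
transitivity ((n%:R - (2 * i)%:R) *+ (x == y) +
   #|[set W in level i | (W \subset enum_val x) && (W \subset enum_val y)]|%:R : rat); last first.
  by congr (_ + _); rewrite -sum_level_card; apply: eq_bigr => z _; rewrite !mxE -natrM mulnb.
have [<-|xy] := eqVneq x y.
  have aux j (P : {set T} -> bool) : [set Z in level j | P Z && P Z] = [set Z in level j | P Z].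
    by apply/setP => Z; rewrite !inE andbb.
  rewrite !aux card_level_above // card_level_below // mulr1n.
  move: Lx; rewrite inE => /and3P[/subset_leq_card l1 /subset_leq_card l2 /eqP c].
  rewrite [(#|B| - _)%N](_ : _ = n - i)%N; last lia.
  by rewrite natrB; [rewrite natrM; ring | lia].
by rewrite mulr0n add0r card_level_between // (inj_eq enum_val_inj).
Qed.

(** The shift a closes the recursion: [incidence_comm] turns a + U U^T into a' + U^T U for the
    matrix U one level down, and Sylvester's identity exchanges the factors. The case of interest is
    a = 0. *)
Definition incidence_det i (a : rat) := \det (a%:M + incidence i *m (incidence i)^T).

Lemma incidence_det1 n a : (#|B| = #|A| + n)%N -> incidence_det 1 a = a + n%:R.
Proof.
move=> cB; rewrite /incidence_det (incidence_comm _ cB) muln0 subr0 addrA -raddfD.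
have -> : (incidence 0)^T *m incidence 0 = 0.
  apply/matrixP => x y; rewrite !mxE big1 // => z.
  by have := ltn_ord z; rewrite [X in (_ < X)%N]card_level0.
by rewrite addr0 det_scalar level1 cards1 expr1.
Qed.

Lemma incidence_det0 a : incidence_det 0 a = 1.
Proof.
rewrite /incidence_det; move: (incidence 0); rewrite card_level0 => M.
by rewrite det_mx00.
Qed.

Lemma incidence_detS n i a : (#|B| = #|A| + n)%N ->
  let a' := a + (n%:R - (2 * i)%:R) in
  a' ^+ #|level i| * incidence_det i.+1 a = a' ^+ #|level i.+1| * incidence_det i a'.
Proof.
move=> cB a'; rewrite /incidence_det (incidence_comm _ cB) addrA -raddfD -/a'.
by rewrite det_scalar_add_mulmxC.
Qed.

Lemma incidence_det_neq0 n i a : (#|B| = #|A| + n)%N ->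
  let a' := a + (n%:R - (2 * i)%:R) in
  a' != 0 -> incidence_det i a' != 0 -> incidence_det i.+1 a != 0.
Proof.
move=> cB a' a0 D0; have := incidence_detS i a cB; rewrite -/a' => /esym/eqP.
by apply: contraTneq => ->; rewrite mulr0 mulf_neq0 ?expf_neq0.
Qed.

(** The recursion read downwards: powers of a shift already in the group cancel. *)
Lemma sqclass_incidence_det n i a : (#|B| = #|A| + n)%N ->
  sqclass_pm2 (a + (n%:R - (2 * i)%:R)) -> sqclass_pm2 (incidence_det i.+1 a) ->
  sqclass_pm2 (incidence_det i (a + (n%:R - (2 * i)%:R))).
Proof.
move=> cB Ta TD; apply: (sqclass_pm2_cancel (sqclass_pm2X #|level i.+1| Ta)).
by rewrite -(incidence_detS _ _ cB); apply: sqclass_pm2M => //; apply: sqclass_pm2X.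
Qed.

End Interval.

(** * Antisymmetrized functions on sets *)

Section SetFunctions.
Local Open Scope ring_scope.
Variable T : finType.
Implicit Types (f h : {set T} -> rat) (B C : {set T}) (p q : T * T) (s : seq (T * T)).

Definition homogeneous m f := forall B, #|B| != m -> f B = 0.

Definition lower f C := \sum_(x | x \notin C) f (x |: C).

Definition harmonic m f := homogeneous m f /\ forall C, lower f C = 0.

Definition swap p B := tperm p.1 p.2 @: B.

Definition antisym s f := forall p, p \in s -> forall B, f (swap p B) = - f B.

Definition disjoint_pairs s := uniq (unzip1 s ++ unzip2 s).

Fixpoint antisymmetrize s f : {set T} -> rat :=
  if s is p :: s' then
    fun B => antisymmetrize s' f B - antisymmetrize s' f (swap p B)
  else f.

Definition transversal s B := all (fun p => (p.1 \in B) && (p.2 \notin B)) s.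

Lemma swapK p : involutive (swap p).
Proof.
move=> B; rewrite /swap -imset_comp -[RHS]imset_id; apply: eq_imset => x /=.
by rewrite tpermK.
Qed.

Lemma card_swap p B : #|swap p B| = #|B|.
Proof. by rewrite card_imset //; apply: perm_inj. Qed.

Lemma mem_swap p B x : (x \in swap p B) = (tperm p.1 p.2 x \in B).
Proof.
by rewrite -{1}(tpermK p.1 p.2 x) mem_imset //; apply: perm_inj.
Qed.

Lemma swapC p q B : p.1 != q.1 -> p.1 != q.2 -> p.2 != q.1 -> p.2 != q.2 ->
  swap p (swap q B) = swap q (swap p B).
Proof.
move=> h1 h2 h3 h4; rewrite /swap -!imset_comp; apply: eq_imset => x /=.
rewrite -!permM conjgC tpermJ !tpermD //; by rewrite eq_sym.
Qed.

Lemma swap_id p B : (p.1 \in B) = (p.2 \in B) -> swap p B = B.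
Proof. by move=> e; apply/setP => x; rewrite mem_swap; case: tpermP => [->|->|]. Qed.

Lemma disjoint_pairs_cons p s : disjoint_pairs (p :: s) =
  [&& p.1 != p.2, p.1 \notin unzip1 s ++ unzip2 s, p.2 \notin unzip1 s ++ unzip2 s
    & disjoint_pairs s].
Proof.
rewrite /disjoint_pairs /= [uniq (unzip1 s ++ _)]uniq_catC /=.
rewrite [uniq (unzip2 s ++ _)]uniq_catC !mem_cat inE.
case: (p.1 == p.2); case: (p.1 \in unzip1 s); case: (p.1 \in unzip2 s);
by case: (p.2 \in unzip1 s); case: (p.2 \in unzip2 s).
Qed.

Lemma neq_pairs p q s : q \in s ->
  p.1 \notin unzip1 s ++ unzip2 s -> p.2 \notin unzip1 s ++ unzip2 s ->
  [/\ p.1 != q.1, p.1 != q.2, p.2 != q.1 & p.2 != q.2].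
Proof.
move=> qs; rewrite !mem_cat !negb_or => /andP[h1 h2] /andP[h3 h4].
have q1 : q.1 \in unzip1 s by apply: map_f.
have q2 : q.2 \in unzip2 s by apply: map_f.
by split; [move: h1 | move: h2 | move: h3 | move: h4]; apply: contraNneq => ->.
Qed.

Lemma antisymmetrize_antisym s f : disjoint_pairs s -> antisym s (antisymmetrize s f).
Proof.
elim: s => [|p s IH] //; rewrite disjoint_pairs_cons => /and4P[p12 p1 p2 /IH {}IH] q.
rewrite inE => /predU1P[->|qs] B /=; first by rewrite swapK opprB.
have [h1 h2 h3 h4] := neq_pairs qs p1 p2.
by rewrite swapC // !(IH q) // opprD opprK addrC.
Qed.

Lemma antisym_cons p s f : antisym (p :: s) f ->
  (forall B, f (swap p B) = - f B) /\ antisym s f.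
Proof.
by move=> a; split=> [|q qs]; apply: a; rewrite inE ?eqxx ?qs ?orbT.
Qed.

Lemma antisym_eq0 s f p B : antisym s f -> p \in s -> (p.1 \in B) = (p.2 \in B) -> f B = 0.
Proof.
move=> a ps e; have := a p ps B; rewrite swap_id // => h.
lra.
Qed.

Lemma transversal_swap p s B :
  p.1 \notin unzip1 s ++ unzip2 s -> p.2 \notin unzip1 s ++ unzip2 s ->
  transversal s (swap p B) = transversal s B.
Proof.
move=> p1 p2; apply: eq_in_all => q qs; have [h1 h2 h3 h4] := neq_pairs qs p1 p2.
by rewrite !mem_swap !tpermD // eq_sym.
Qed.

(** A set meeting some pair in zero or two points is fixed by that swap, so f vanishes there; any
    other set is carried by swaps to a transversal one at the cost of signs. *)
Lemma antisym_transversal s f : disjoint_pairs s -> antisym s f ->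
  (forall B, transversal s B -> f B = 0) -> forall B, f B = 0.
Proof.
elim: s => [|p s IH] ds af f0 B; first exact: f0.
move: ds; rewrite disjoint_pairs_cons => /and4P[p12 p1 p2 ds].
have [ap afs] := antisym_cons af.
apply: IH => // {}B tB.
have [e|e] := eqVneq (p.1 \in B) (p.2 \in B).
  by apply: (antisym_eq0 af) e; rewrite mem_head.
have [pB|pB] := boolP (p.1 \in B); first by apply: f0; rewrite /= tB; move: e; rewrite pB; case: (_ \in _).
apply: oppr_inj; rewrite oppr0 -ap; apply: f0; rewrite /= !mem_swap tpermL tpermR pB.
by rewrite transversal_swap // tB; move: e; rewrite (negPf pB); case: (_ \in _).
Qed.

(* A product of two antisymmetric functions is invariant under the swaps, so that its
   sum over all sets is determined by the sets containing the first element of each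
   pair and not the second one. *)
Lemma sum_antisym_mul s f h : disjoint_pairs s -> antisym s f -> antisym s h ->
  \sum_B f B * h B = 2 ^+ size s * \sum_(B | transversal s B) f B * h B.
Proof.
elim: s => [|p s IH] ds af ah; first by rewrite mul1r.
move: ds; rewrite disjoint_pairs_cons => /and4P[p12 p1 p2 ds].
have [afp afs] := antisym_cons af; have [ahp ahs] := antisym_cons ah.
rewrite IH // exprSr -mulrA; congr (_ * _).
rewrite (bigID (fun B => p.1 \in B)) /= mulr_natl mulr2n; congr (_ + _).
  rewrite (bigID (fun B => p.2 \in B)) /= big1 ?add0r.
    by apply: eq_bigl => B; rewrite -/(transversal s B) [RHS]andbC andbA.
  move=> B /andP[/andP[_ e1] e2]; rewrite (antisym_eq0 (p := p) af) ?mul0r ?mem_head //.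
  by rewrite e1 e2.
rewrite (bigID (fun B => p.2 \in B)) /= [X in _ + X]big1 ?addr0; last first.
  move=> B /andP[/andP[_ e1] e2]; rewrite (antisym_eq0 (p := p) af) ?mul0r ?mem_head //.
  by rewrite (negPf e1) (negPf e2).
rewrite (reindex_inj (can_inj (swapK p))) /=.
apply: eq_big => [B|B _]; last by rewrite afp ahp mulrNN.
by rewrite transversal_swap // !mem_swap tpermL tpermR -/(transversal s B);
  case: (p.1 \in B); case: (p.2 \in B); rewrite ?andbT ?andbF.
Qed.

Lemma lower_imset (g : {perm T}) f C :
  lower (fun B => f (g @: B)) C = lower f (g @: C).
Proof.
rewrite /lower [RHS](reindex_inj (@perm_inj _ g)) /=.
apply: eq_big => [x|x _]; first by rewrite mem_imset //; apply: perm_inj.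
by rewrite imsetU1.
Qed.

Lemma harmonic_swap m p f : harmonic m f -> harmonic m (fun B => f (swap p B)).
Proof.
case=> hf lf; split=> [B cB|C]; first by rewrite hf ?card_swap.
by rewrite (lower_imset (tperm p.1 p.2)) lf.
Qed.

Lemma harmonicB m f h : harmonic m f -> harmonic m h -> harmonic m (fun B => f B - h B).
Proof.
case=> hf lf [hh lh]; split=> [B cB|C]; first by rewrite hf ?hh ?subr0.
by rewrite /lower sumrB -/(lower f C) -/(lower h C) lf lh subr0.
Qed.

Lemma harmonic_antisymmetrize m s f : harmonic m f -> harmonic m (antisymmetrize s f).
Proof.
move=> hf; elim: s => [|p s IH] //=; apply: harmonicB => //.
exact: harmonic_swap.
Qed.

(** Pairs are adjoined one at a time. If every further pair of free points killed the current
    function, it would be symmetric in these points, against harmonicity. *)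
Lemma exists_antisymmetrize m f j : harmonic m f -> (exists B, f B != 0) -> (j <= m)%N ->
  exists s, [/\ size s = j, disjoint_pairs s & exists B, antisymmetrize s f B != 0].
Proof.
move=> hf f0; elim: j => [|j IH] jm; first by exists [::].
have [s [ss ds [B wB]]] := IH (ltnW jm).
set w := antisymmetrize s f in wB; have aw : antisym s w by apply: antisymmetrize_antisym.
have [hw lw] : harmonic m w by apply: harmonic_antisymmetrize.
have cB : #|B| = m by apply/eqP; apply: contraR wB => /hw->; rewrite eqxx.
pose D := unzip1 s ++ unzip2 s.
have one p : p \in s -> (p.1 \in B) != (p.2 \in B).
  by move=> ps; apply: contraNneq wB => /(antisym_eq0 aw ps) ->.
(* [B] has m > j points and meets each of the j pairs in exactly one, so one of its points is in no
   pair. *)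
have [x xB xD] : exists2 x, x \in B & x \notin D.
  apply/exists_inP; rewrite -negb_forall_in; apply: contraL jm => /forall_inP BD.
  rewrite -leqNgt -cB -ss -(size_map (fun p => if p.1 \in B then p.1 else p.2)).
  apply: leq_trans (card_size _); apply/subset_leq_card/subsetP => y yB.
  have := BD y yB; rewrite mem_cat => /orP[] /mapP[p ps Dy]; apply/mapP; exists p => //.
    by rewrite -Dy yB.
  by have := one p ps; rewrite -Dy yB; case: (_ \in _).
have [/existsP[a /existsP[b /and4P[aD bD ab /existsP[B' B'0]]]]|noab] :=
  boolP [exists a, exists b, [&& a \notin D, b \notin D, a != b
           & [exists B', w B' - w (swap (a, b) B') != 0]]].
  exists ((a, b) :: s); split; rewrite /= ?ss //; last by exists B'.
  by rewrite disjoint_pairs_cons /= ab ds aD bD.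
(* Now w is invariant under all swaps outside D, so that lower w (B :\ x) is a
   positive multiple of w B. *)
have inv a : a \notin D -> w (swap (a, x) B) = w B.
  move=> aD; have [->|ax] := eqVneq a x; first by rewrite swap_id.
  apply/eqP; rewrite eq_sym -subr_eq0; apply: contraNT noab => n0.
  apply/existsP; exists a; apply/existsP; exists x; rewrite aD xD ax.
  by apply/existsP; exists B.
pose C := B :\ x.
(* If a is in a pair, it is not in [B] and its partner is in [C], so adding a to [C] completes the
   pair. Otherwise the swap of a and x carries [B] to the set in question. *)
have term a : a \notin C -> w (a |: C) = (a \notin D)%:R * w B.
  move=> aC; have [aD|aD] := boolP (a \in D); last first.
    rewrite mul1r -(inv a aD); congr w; apply/setP => y; rewrite mem_swap !inE /=.
    case: tpermP => [->|->|/eqP ya /eqP yx]; first by rewrite eqxx xB.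
      by move: aC; rewrite !inE eqxx orbF; case: eqVneq => [->|_ /= /negPf->] //; rewrite xB.
    by rewrite (negPf ya) yx.
  rewrite mul0r; have xnD y : y \in D -> (y == x) = false.
    by move=> yD; apply: contraNF xD => /eqP <-.
  move: (aD); rewrite mem_cat => /orP[] /mapP[p ps Da];
    apply: (antisym_eq0 aw ps); rewrite !inE -Da eqxx /=; have := one p ps;
    move: aC; rewrite !inE (xnD a aD) -Da /= => /negPf->.
    have -> /= : (p.2 == x) = false by apply: xnD; rewrite mem_cat map_f ?orbT.
    by case: (p.2 \in B); rewrite ?orbT.
  have -> /= : (p.1 == x) = false by apply: xnD; rewrite mem_cat map_f.
  by case: (p.1 \in B); rewrite ?orbT.
have := lw C; rewrite /lower (eq_bigr _ term) -big_distrl /= => /eqP.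
rewrite mulf_eq0 (negPf wB) orbF -natr_sum pnatr_eq0 sum_nat_eq0 => /forall_inP/(_ x).
by rewrite !inE eqxx xD => /(_ isT).
Qed.

Lemma antisymmetrize_support x s f : x \notin unzip1 s ++ unzip2 s ->
  (forall B, x \notin B -> f B = 0) -> forall B, x \notin B -> antisymmetrize s f B = 0.
Proof.
elim: s => [|p s IH] //= xs f0 B xB.
have [xp1 xp2 {}xs] : [/\ x != p.1, x != p.2 & x \notin unzip1 s ++ unzip2 s].
  move: xs; rewrite inE negb_or !mem_cat inE !negb_or => /andP[-> /andP[-> /andP[-> ->]]].
  by split.
by rewrite !IH ?subr0 // mem_swap tpermD // eq_sym.
Qed.

(** Every term with a swap is evaluated at a set lacking the first point of that pair, outside the
    support of f. *)
Lemma antisymmetrize_transversal s f B : disjoint_pairs s -> transversal s B ->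
  (forall B, ~~ transversal s B -> f B = 0) -> antisymmetrize s f B = f B.
Proof.
elim: s => [|p s IH] //=; rewrite disjoint_pairs_cons => /and4P[p12 p1 p2 ds].
case/andP=> /andP[pB1 pB2] tB f0.
rewrite IH // => [|B' tB']; last by rewrite f0 // (negPf tB') andbF.
rewrite (@antisymmetrize_support p.1) ?subr0 // => [B' pB'|]; first by rewrite f0 // (negPf pB').
by rewrite mem_swap tpermL.
Qed.

End SetFunctions.

(** * Antisymmetric harmonic functions as kernel vectors of an inclusion matrix *)

Section LevelVector.
Local Open Scope ring_scope.
Variables (T : finType) (s : seq (T * T)).
Hypothesis ds : disjoint_pairs s.

Let A := [set x in unzip1 s].
Let B := ~: [set x in unzip2 s].
Local Notation level := (level A B).

Lemma disjoint_pairs_sub : A \subset B.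
Proof.
apply/subsetP => x; rewrite !inE => x1; apply/negP => x2.
move: ds; rewrite /disjoint_pairs cat_uniq => /and3P[_ /hasPn/(_ _ x2)].
by rewrite x1.
Qed.

Lemma card_unzip1 : #|A| = size s.
Proof.
move: ds; rewrite /disjoint_pairs cat_uniq => /and3P[u _ _].
by rewrite cardsE (card_uniqP u) size_map.
Qed.

Lemma card_unzip2 : (#|B| + size s = #|T|)%N.
Proof.
move: ds; rewrite /disjoint_pairs cat_uniq => /and3P[_ _ u].
have e : #|[set x in unzip2 s]| = size s by rewrite cardsE (card_uniqP u) size_map.
by rewrite -(cardsC [set x in unzip2 s]) e addnC.
Qed.

Lemma transversalE C : transversal s C = (A \subset C) && (C \subset B).
Proof.
apply/allP/andP => [h|[/subsetP h1 /subsetP h2] p ps].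
  split; apply/subsetP => x; rewrite inE.
    by case/mapP=> p /h /andP[p1 _] ->.
  by move=> xC; rewrite inE; apply/negP => /mapP[p /h /andP[_ p2] Dx]; rewrite -Dx xC in p2.
rewrite h1 ?inE ?map_f //; apply/negP => /h2; rewrite !inE.
by rewrite map_f.
Qed.

Lemma transversal_level k C : transversal s C -> #|C|.+1 = (size s + k)%N -> C \in level k.
Proof. by rewrite transversalE inE andbA => -> ->; rewrite card_unzip1 eqxx. Qed.

Lemma level_transversal k C : C \in level k -> transversal s C /\ #|C|.+1 = (size s + k)%N.
Proof. by rewrite transversalE inE andbA => /andP[-> /eqP->]; rewrite card_unzip1. Qed.

(** Adding the second point of a pair to a transversal set completes the pair, where f vanishes;
    only sets of the interval contribute. *)
Lemma lower_level k f C : antisym s f -> C \in level k ->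
  lower f C = \sum_(D in level k.+1 | C \subset D) f D.
Proof.
move=> af LC; rewrite /lower (bigID (mem [set x in unzip2 s])) /= big1 ?add0r; last first.
  move=> x /andP[xC]; rewrite inE => /mapP[p ps Dx]; apply: (antisym_eq0 af ps).
  have [/allP/(_ p ps)/andP[p1 p2] _] := level_transversal LC.
  by rewrite !inE -Dx eqxx p1 orbT.
rewrite [RHS](eq_bigl (mem ((fun z => z |: C) @: (B :\: C)))); last first.
  by move=> D; rewrite -(level_above disjoint_pairs_sub LC) !inE.
rewrite big_imset /=; last first.
  by move=> x y; rewrite !inE => /andP[xX _] /andP[yX _]; apply: setU1_inj; rewrite inE.
by apply: eq_bigl => x; rewrite !inE.
Qed.

Definition level_vec k (f : {set T} -> rat) : 'rV_#|level k.+1| :=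
  \row_y f (enum_val y).

Lemma level_vec_incidence k f (x : 'I_#|level k|) :
  (level_vec k f *m (incidence A B k)^T) 0 x
  = \sum_(D in level k.+1 | enum_val x \subset D) f D.
Proof.
rewrite mxE [RHS]big_mkcondr /=.
rewrite (big_enum_val (fun D : {set T} => if enum_val x \subset D then f D else 0)) /=.
apply: eq_bigr => y _.
by rewrite !mxE; case: ifP => _; rewrite ?mulr1 ?mulr0.
Qed.

Lemma level_vec_harmonic k f : antisym s f -> harmonic (size s + k)%N f ->
  level_vec k f *m (incidence A B k)^T = 0.
Proof.
move=> af [_ lf]; apply/rowP => x.
by rewrite level_vec_incidence -lower_level ?enum_valP // lf mxE.
Qed.

Lemma homogeneous_antisymmetrize m f : homogeneous m f -> homogeneous m (antisymmetrize s f).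
Proof.
move=> hf; elim: (s) => [|p s' IH] //= C cC.
by rewrite !IH ?subr0 ?card_swap.
Qed.

(** The kernel vector is extended by 0 and antisymmetrized, which does not change its values on the
    interval. *)
Lemma level_vec_surj k (u : 'rV_#|level k.+1|) : u *m (incidence A B k)^T = 0 ->
  exists f, [/\ antisym s f, harmonic (size s + k)%N f & level_vec k f = u].
Proof.
move=> u0.
pose h (D : {set T}) := \sum_y (u 0 y *+ (enum_val y == D)).
have hE y : h (enum_val y) = u 0 y.
  rewrite /h (bigD1 y) //= eqxx big1 ?addr0 // => z zy.
  by rewrite (inj_eq enum_val_inj) (negPf zy).
have h0 D : D \notin level k.+1 -> h D = 0.
  move=> LD; apply: big1 => y _; case: eqP => // Dy.
  by have := enum_valP y; rewrite Dy (negPf LD).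
have hom : homogeneous (size s + k)%N h.
  move=> D cD; apply: h0; apply: contra cD => /level_transversal[_].
  by rewrite addnS => -[->].
pose f := antisymmetrize s h.
have af : antisym s f by apply: antisymmetrize_antisym.
have homf : homogeneous (size s + k)%N f by apply: homogeneous_antisymmetrize.
have fE D : D \in level k.+1 -> f D = h D.
  move=> LD; have [tD _] := level_transversal LD.
  apply: antisymmetrize_transversal => // D' tD'; apply: h0; apply: contra tD'.
  by case/level_transversal.
have vf : level_vec k f = u.
  by apply/rowP => y; rewrite mxE fE ?enum_valP.
exists f; split=> //; split=> // C.
(* [lower f] is antisymmetric too, so only transversal sets matter, and there it is an entry of the
   kernel equation. *)
move: C; apply: (antisym_transversal (f := lower f) ds) => [p ps C|C tC].
  rewrite -(lower_imset (tperm p.1 p.2)) /lower -sumrN; apply: eq_bigr => x _.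
  by rewrite -/(swap p _) af.
have [cC|cC] := eqVneq #|C|.+1 (size s + k)%N; last first.
  by apply: big1 => x xC; rewrite homf // cardsU1 xC.
have LC := transversal_level tC cC; rewrite (lower_level af LC).
have := congr1 (fun v : 'rV__ => v 0 (enum_rank_in LC C)) u0.
by rewrite -vf level_vec_incidence mxE enum_rankK_in.
Qed.

Lemma sum_level_vec k f h : antisym s f -> antisym s h -> homogeneous (size s + k)%N f ->
  \sum_D f D * h D = 2 ^+ size s * (level_vec k f *m (level_vec k h)^T) 0 0.
Proof.
move=> af ah hf; rewrite (sum_antisym_mul ds) //; congr (_ * _).
rewrite mxE (eq_bigr (fun y => f (enum_val y) * h (enum_val y))); last by move=> y _; rewrite !mxE.
rewrite -(big_enum_val (fun D => f D * h D)) /=.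
rewrite (bigID (mem (level k.+1))) /= [X in _ + X]big1 ?addr0.
  by apply: eq_bigl => D; rewrite andb_idl // => /level_transversal[].
move=> D /andP[tD LD]; rewrite hf ?mul0r //; apply: contra LD => /eqP cD.
by apply: transversal_level; rewrite // cD addnS.
Qed.

End LevelVector.

(** * The antisymmetrizer as a self-adjoint quasi-idempotent *)

Section Antisymmetrizers.
Local Open Scope ring_scope.
Variable T : finType.
Implicit Types (f h : {set T} -> rat) (s : seq (T * T)).

Lemma antisymmetrize_comb d s (a : 'I_d -> rat) (b : 'I_d -> {set T} -> rat) f :
  (forall B, f B = \sum_i a i * b i B) ->
  forall B, antisymmetrize s f B = \sum_i a i * antisymmetrize s (b i) B.
Proof.
move=> fE; elim: s => [|p s IH] //= B; rewrite !IH -sumrB.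
by apply: eq_bigr => i _; rewrite mulrBr.
Qed.

Lemma antisymmetrizeK s f : antisym s f ->
  forall B, antisymmetrize s f B = 2 ^+ size s * f B.
Proof.
elim: s => [|p s IH] af B /=; first by rewrite mul1r.
have [ap afs] := antisym_cons af.
by rewrite !IH // ap exprS; ring.
Qed.

(** Swaps are self-adjoint for the sum over all sets, and each acts on f as -1. *)
Lemma sum_antisym_antisymmetrize s f h : antisym s f ->
  \sum_B f B * antisymmetrize s h B = 2 ^+ size s * \sum_B f B * h B.
Proof.
elim: s => [|p s IH] af /=; first by rewrite mul1r.
have [ap afs] := antisym_cons af.
rewrite exprS -mulrA -IH // -[LHS]addr0.
under eq_bigr do rewrite mulrBr.
rewrite sumrB addr0 [X in _ - X](reindex_inj (can_inj (swapK p))) /=.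
under [X in _ - X]eq_bigr do rewrite swapK ap mulNr.
by rewrite sumrN opprK mulr_natl mulr2n.
Qed.

Lemma exists_disjoint_pairs j : (2 * j <= #|T|)%N ->
  exists2 s : seq (T * T), size s = j & disjoint_pairs s.
Proof.
move=> le; pose e := enum T.
have se : size e = #|T| by rewrite -cardE.
have s1 : size (take j e) = j by rewrite size_takel // se; lia.
have s2 : size (take j (drop j e)) = j by rewrite size_takel // size_drop se; lia.
exists (zip (take j e) (take j (drop j e))); first by rewrite size1_zip s1 ?s2.
rewrite /disjoint_pairs unzip1_zip ?unzip2_zip ?s1 ?s2 // -takeD.
exact/take_uniq/enum_uniq.
Qed.

End Antisymmetrizers.

(** * The arithmetic obstruction to an invariant unimodular lattice *)

Section InvariantLattice.
Local Open Scope ring_scope.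
Variables (T : finType) (m d : nat) (b : 'I_d -> {set T} -> rat).
Variables (G : 'M[int]_d) (c : rat).
Hypothesis b_harm : forall i, harmonic m (b i).
Hypothesis b_span : forall f, harmonic m f ->
  exists a : 'I_d -> rat, forall B, f B = \sum_i a i * b i B.
Hypothesis b_stable : forall p, exists E : 'M[int]_d,
  forall i B, b i (swap p B) = \sum_j (E i j)%:~R * b j B.
Hypothesis G_gram : forall i j, (G i j)%:~R = c * \sum_B b i B * b j B.
Hypothesis G_unit : G \in unitmx.

Let comb r (P : 'M[int]_(r, d)) i B := \sum_j (P i j)%:~R * b j B.

Lemma antisymmetrize_matrix (s : seq (T * T)) : exists E : 'M[int]_d,
  forall i B, antisymmetrize s (b i) B = comb E i B.
Proof.
elim: s => [|p s [E EP]] /=.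
  exists 1%:M => i B; rewrite /comb (bigD1 i) //= mxE eqxx mul1r big1 ?addr0 // => j ji.
  by rewrite mxE eq_sym (negPf ji) mul0r.
have [F FP] := b_stable p; exists (E - E *m F) => i B.
rewrite !EP /comb; under [X in _ - X]eq_bigr do rewrite FP mulr_sumr.
rewrite exchange_big -sumrB /=; apply: eq_bigr => j _.
rewrite !mxE rmorphB rmorph_sum mulrBl mulr_suml /=; congr (_ - _).
by apply: eq_bigr => k _; rewrite rmorphM mulrA.
Qed.

Lemma comb_mul q r (M : 'M[int]_(q, r)) (P : 'M[int]_(r, d)) i B :
  comb (M *m P) i B = \sum_k (M i k)%:~R * comb P k B.
Proof.
rewrite /comb; under [RHS]eq_bigr do rewrite mulr_sumr.
rewrite exchange_big; apply: eq_bigr => j _; rewrite mxE rmorph_sum mulr_suml.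
by apply: eq_bigr => k _; rewrite rmorphM mulrA.
Qed.

Lemma comb_gram q r (M : 'M[int]_(q, d)) (P : 'M[int]_(r, d)) i j :
  ((M *m G *m P^T) i j)%:~R = c * \sum_B comb M i B * comb P j B.
Proof.
rewrite mxE rmorph_sum /=.
transitivity (\sum_k \sum_l (M i l)%:~R * (P j k)%:~R * (c * \sum_B b l B * b k B)).
  apply: eq_bigr => k _; rewrite !mxE rmorphM rmorph_sum mulr_suml /=.
  by apply: eq_bigr => l _; rewrite rmorphM -G_gram mulrAC.
under [in RHS]eq_bigr => B _.
  rewrite /comb big_distrlr /= exchange_big /=; over.
rewrite [in RHS]exchange_big [RHS]mulr_sumr; apply: eq_bigr => k _ /=.
rewrite [in RHS]exchange_big [RHS]mulr_sumr; apply: eq_bigr => l _ /=.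
rewrite mulrCA; congr (_ * _); rewrite mulr_sumr; apply: eq_bigr => B _; ring.
Qed.

(** Invertibility of the Gram matrix makes the family b independent. *)
Lemma comb_inj r (M N : 'M[int]_(r, d)) :
  (forall i B, comb M i B = comb N i B) -> M = N.
Proof.
move=> e; have h : M *m G = N *m G.
  apply/matrixP => i j; apply: (@intr_inj rat).
  have := comb_gram M 1%:M i j; have := comb_gram N 1%:M i j.
  rewrite trmx1 !mulmx1 => -> ->; congr (_ * _).
  by apply: eq_bigr => B _; rewrite e.
by rewrite -[M](mulmxK G_unit) h mulmxK.
Qed.

Lemma comb_scale r (t : int) (M : 'M[int]_(r, d)) i B :
  comb (t *: M) i B = t%:~R * comb M i B.
Proof.
by rewrite /comb mulr_sumr; apply: eq_bigr => j _; rewrite mxE rmorphM mulrA.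
Qed.

Lemma det_dvd_pow2 r (H K : 'M[int]_r) j : H *m K = (2 ^+ j)%:M ->
  exists e a, \det H = (-1) ^+ e * 2 ^+ a.
Proof.
move/(congr1 determinant); rewrite det_mulmx det_scalar -exprM => /(congr1 absz).
rewrite abszM abszX /= => h.
have : (`|\det H|%N %| 2 ^ (j * r))%N by rewrite -h dvdn_mulr.
case/(dvdn_pfactor _ _ (isT : prime 2)) => a _ Da.
exists (\det H < 0)%R, a; rewrite [LHS]intEsign Da; congr (_ * _).
by rewrite -natz natrX natz.
Qed.

Lemma row_free_gram r q (Y : 'M[rat]_(r, q)) : \det (Y *m Y^T) != 0 -> row_free Y.
Proof.
move=> D; apply/row_freeP; exists (Y^T *m invmx (Y *m Y^T)).
by rewrite mulmxA mulmxV // unitmxE unitfE.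
Qed.

(** The rows of [P] are a basis of a direct summand that spans the image of the antisymmetrizer over
    Q. Their Gram matrix [H] divides a power of 2, while their values [Y] on the interval form a
    basis of the kernel of the incidence matrix U, so [det_gram_complement] trades det(Y Y^T) for
    det(U U^T). *)
Lemma sqclass_level (s : seq (T * T)) k : disjoint_pairs s -> (size s + k = m)%N ->
  let A := [set x in unzip1 s] in let B := ~: [set x in unzip2 s] in
  incidence_det A B k 0 != 0 ->
  sqclass_pm2 (c ^+ (#|level A B k.+1| - #|level A B k|) * incidence_det A B k 0).
Proof.
move=> ds sk A B D0.
have [E EP] := antisymmetrize_matrix s.
pose t : int := 2 ^+ size s.
have tQ : t%:~R = 2 ^+ size s :> rat by rewrite /t rmorphXn.
have t0 : t%:~R != 0 :> rat by rewrite tQ expf_neq0.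
have antiE i : antisym s (comb E i).
  by move=> p ps C; rewrite -!EP; apply: antisymmetrize_antisym.
have EE : E *m E = t *: E.
  apply: comb_inj => i C; rewrite comb_mul comb_scale tQ -antisymmetrizeK //.
  rewrite (antisymmetrize_comb s (a := fun j => (E i j)%:~R) (b := b)) //.
  by apply: eq_bigr => j _; rewrite EP.
have [r [P [S [L [PS EL PL]]]]] := quasi_idempotent_factor EE.
have PE : P *m E = t *: P by rewrite EL mulmxA PL mul_scalar_mx.
have antiP i : antisym s (comb P i).
  move=> p ps C; apply: (mulfI t0); rewrite mulrN -!comb_scale -PE !comb_mul -sumrN.
  by apply: eq_bigr => j _; rewrite antiE // mulrN.
have harmP i : harmonic m (comb P i).
  split=> [C cC|C].
    by apply: big1 => j _; have [h _] := b_harm j; rewrite h // mulr0.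
  rewrite /lower exchange_big big1 //= => j _; rewrite -mulr_sumr.
  by have [_ h] := b_harm j; rewrite -/(lower (b j) C) h mulr0.
have homP i : homogeneous (size s + k)%N (comb P i) by rewrite sk; case: (harmP i).
(* Self-adjointness of the antisymmetrizer, in coordinates. *)
have PGE : P *m G *m E^T = t *: (P *m G).
  apply/matrixP => i j; apply: (@intr_inj rat).
  rewrite comb_gram; under eq_bigr do rewrite -EP.
  rewrite sum_antisym_antisymmetrize // mxE rmorphM /= tQ.
  have := comb_gram P 1%:M i j; rewrite trmx1 mulmx1 => ->.
  rewrite mulrCA; congr (_ * (_ * _)); apply: eq_bigr => C _; congr (_ * _).
  rewrite /comb (bigD1 j) //= mxE eqxx mul1r big1 ?addr0 // => l lj.
  by rewrite mxE eq_sym (negPf lj) mul0r.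
pose H := P *m G *m P^T.
(* H L^T = P G E^T = t P G, after which [G] and [P] are inverted on the right. *)
have HK : H *m (L^T *m invmx G *m S) = t%:M.
  rewrite /H !mulmxA -(mulmxA _ P^T) -trmx_mul -EL PGE -!scalemxAl mulmxK //.
  by rewrite PS scalemx1.
have [e [a DH]] := det_dvd_pow2 HK.
pose Y := \matrix_(i < r) level_vec s k (comb P i).
have Dc : (\det H)%:~R = (c * 2 ^+ size s) ^+ r * \det (Y *m Y^T).
  rewrite -detZ -det_map_mx; congr (\det _); apply/matrixP => i j.
  transitivity (((P *m G *m P^T) i j)%:~R : rat); first by rewrite mxE.
  rewrite comb_gram (sum_level_vec (k := k) ds) //.
  rewrite mulrA [RHS]mxE; congr (_ * _); rewrite !mxE; apply: eq_bigr => y _.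
  by rewrite !mxE.
have Hcl : sqclass_pm2 (\det H)%:~R.
  by rewrite DH rmorphM !rmorphXn /= rmorphN1; apply: sqclass_pm2_signed_pow2.
have gY0 : \det (Y *m Y^T) != 0.
  by apply: contraTneq (sqclass_pm2_neq0 Hcl) => g0; rewrite Dc g0 mulr0 eqxx.
have D0' : \det (incidence A B k *m (incidence A B k)^T) = incidence_det A B k 0.
  by rewrite /incidence_det raddf0 add0r.
have fY := row_free_gram gY0.
have fI : row_free (incidence A B k) by apply: row_free_gram; rewrite D0'.
have YI : Y *m (incidence A B k)^T = 0.
  apply/row_matrixP => i; rewrite row_mul rowK row0.
  by apply: level_vec_harmonic; rewrite ?sk.
have sYK : (Y :=: kermx (incidence A B k)^T)%MS.
  apply/eqmxP/andP; split; first exact/sub_kermxP.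
  apply/row_subP => i; set u := row i _.
  have [|f [af hf <-]] := level_vec_surj ds (k := k) (u := u).
    by apply/sub_kermxP; apply: row_sub.
  rewrite sk in hf; have [al fE] := b_span hf.
  (* f is its own antisymmetrization divided by t, and E = L P expresses the latter through the rows
     of [P]. *)
  apply/submxP; exists (\row_l (t%:~R^-1 * \sum_j al j * (L j l)%:~R)).
  apply/rowP => y; rewrite !mxE; apply: (mulfI t0); rewrite {1}tQ -antisymmetrizeK //.
  rewrite (antisymmetrize_comb s fE) mulr_sumr.
  transitivity (\sum_j \sum_l al j * ((L j l)%:~R * comb P l (enum_val y))).
    by apply: eq_bigr => j _; rewrite EP EL comb_mul mulr_sumr.
  rewrite exchange_big; apply: eq_bigr => l _ /=.
  rewrite !mxE mulrA mulrA mulfV // mul1r mulr_suml.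
  by apply: eq_bigr => j _; rewrite mulrA.
have rk : (r + #|level A B k| = #|level A B k.+1|)%N.
  have /eqP <- : \rank Y == r := fY.
  rewrite sYK mxrank_ker mxrank_tr (eqP fI) subnK //.
  by rewrite -{1}(eqP fI) rank_leq_col.
have [q Dq] := det_gram_complement rk YI.
rewrite D0' in Dq; rewrite -rk addnK.
have q0 : q != 0 by rewrite -sqrf_eq0 Dq mulf_neq0.
apply: (@sqclass_pm2_cancel ((2 ^+ size s) ^+ r * \det (Y *m Y^T) ^+ 2)).
  apply: sqclass_pm2M (sqclass_pm2_sqr gY0); apply: sqclass_pm2X.
  by have := sqclass_pm2_signed_pow2 0 (size s); rewrite expr0 mul1r.
have -> : (2 ^+ size s) ^+ r * \det (Y *m Y^T) ^+ 2 * (c ^+ r * incidence_det A B k 0)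
  = (\det H)%:~R * q ^+ 2.
  by rewrite Dq Dc exprMn; ring.
by apply: sqclass_pm2M Hcl _; apply: sqclass_pm2_sqr.
Qed.

(** Here N is n - 2m, one less than in the overview, and m - k pairs leave an interval of rank N +
    2k. The shifts met by the recursion are N + 2 and then 2 (N + 3); smaller values of k have
    already put them in the group, so only the last determinant, N + 2, 2 (N + 3) or 3 (N + 4), is
    new. *)
Lemma no_unimodular_invariant_lattice : (2 < m)%N -> (2 * m <= #|T|)%N -> False.
Proof.
move=> m3 mT; pose N := (#|T| - 2 * m)%N.
have key k : (k <= m)%N -> exists A B : {set T},
    [/\ A \subset B, (#|B| = #|A| + (N + 2 * k))%N &
      incidence_det A B k 0 != 0 ->
      sqclass_pm2 (c ^+ (#|level A B k.+1| - #|level A B k|) * incidence_det A B k 0)].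
  move=> km; have [|s ss ds] := @exists_disjoint_pairs T (m - k); first lia.
  exists [set x in unzip1 s], (~: [set x in unzip2 s]); split.
  - exact: disjoint_pairs_sub.
  - have := card_unzip2 ds; rewrite (card_unzip1 ds) ss /N; lia.
  by apply: sqclass_level => //; rewrite ss subnK.
have Tc : sqclass_pm2 c.
  have [A [B [sAB _]]] := key 0 isT.
  by rewrite incidence_det0 oner_neq0 level1 // cards1 card_level0 expr1 mulr1; apply.
have {}key k : (k <= m)%N -> exists A B : {set T},
    [/\ A \subset B, (#|B| = #|A| + (N + 2 * k))%N &
      incidence_det A B k 0 != 0 -> sqclass_pm2 (incidence_det A B k 0)].
  move=> /key[A [B [sAB cB D]]]; exists A, B; split=> // D0.
  exact: sqclass_pm2_cancel (sqclass_pm2X _ Tc) (D D0).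
have T1 : sqclass_pm2 (N.+2)%:R.
  have [|A [B [sAB cB]]] := key 1%N; first lia.
  rewrite (incidence_det1 sAB _ cB) add0r muln1 addn2; apply.
  by rewrite pnatr_eq0.
have a1 k : 0 + ((N + 2 * k.+1)%:R - (2 * k)%:R) = (N.+2)%:R :> rat.
  by rewrite add0r -natrB; [congr _%:R; lia | lia].
have T2 : sqclass_pm2 (2 * N.+3)%:R.
  have [|A [B [sAB cB]]] := key 2%N; first lia.
  have D1 : incidence_det A B 1 (N.+2)%:R = (2 * N.+3)%:R.
    by rewrite (incidence_det1 sAB _ cB) -natrD; congr _%:R; lia.
  have := @incidence_det_neq0 _ A B sAB _ 1 0 cB; rewrite /= a1 D1 !pnatr_eq0 muln_eq0.
  move=> /(_ isT isT) D2 /(_ D2); rewrite -D1 -(a1 1%N).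
  by apply: sqclass_incidence_det => //; rewrite a1.
have T3 : sqclass_pm2 (3 * N.+4)%:R.
  have [//|A [B [sAB cB]]] := key 3%N.
  have a2 : (N.+2)%:R + ((N + 2 * 3)%:R - (2 * 1)%:R) = (2 * N.+3)%:R :> rat.
    by rewrite -natrB; [rewrite -natrD; congr _%:R; lia | lia].
  have D1 : incidence_det A B 1 (2 * N.+3)%:R = (3 * N.+4)%:R.
    by rewrite (incidence_det1 sAB _ cB) -natrD; congr _%:R; lia.
  have D2 := @incidence_det_neq0 _ A B sAB _ 1 (N.+2)%:R cB.
  rewrite /= a2 D1 !pnatr_eq0 !muln_eq0 in D2.
  have := @incidence_det_neq0 _ A B sAB _ 2 0 cB; rewrite /= a1 pnatr_eq0.
  move=> /(_ isT (D2 isT isT)) D3 /(_ D3) TD3; rewrite -D1 -a2.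
  apply: sqclass_incidence_det => //; first by rewrite a2.
  by rewrite -(a1 2%N); apply: sqclass_incidence_det => //; rewrite a1.
by apply: (@no_square_triple N.+1) => //; apply: sqclass_pm2_nat.
Qed.

End InvariantLattice.

(** * Two-row Specht modules *)

Section FullAntisymmetry.
Local Open Scope ring_scope.
Variables (T : finType) (s : seq (T * T)).
Hypothesis ds : disjoint_pairs s.
Implicit Types f h : {set T} -> rat.

Lemma transversal_full B : transversal s B -> #|B| = size s -> B = [set x in unzip1 s].
Proof.
rewrite (transversalE s) => /andP[sB _] cB; apply/esym/eqP.
by rewrite eqEcard sB cB (card_unzip1 ds) leqnn.
Qed.

(** The set of first points is the only transversal set of its size, so the value there determines
    each function and the space is a line. *)
Lemma antisym_full_eq f h : antisym s f -> antisym s h ->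
  homogeneous (size s) f -> homogeneous (size s) h ->
  forall B, f B * h [set x in unzip1 s] = h B * f [set x in unzip1 s].
Proof.
move=> af ah hf hh B; apply/eqP; rewrite -subr_eq0; apply/eqP; move: B.
set A := [set x in unzip1 s].
apply: (antisym_transversal (f := fun B => f B * h A - h B * f A) ds) => [p ps B|B tB].
  by rewrite af // ah // !mulNr opprD.
have [cB|cB] := eqVneq #|B| (size s); last by rewrite (hf B) // (hh B) // !mul0r subr0.
by rewrite (transversal_full tB cB) mulrC subrr.
Qed.

Lemma antisym_full_neq0 f : antisym s f -> homogeneous (size s) f ->
  (exists B, f B != 0) -> f [set x in unzip1 s] != 0.
Proof.
move=> af hf [B]; apply: contraNneq => fA; apply/eqP; move: B.
apply: (antisym_transversal ds af) => B tB.
have [cB|cB] := eqVneq #|B| (size s); last by rewrite hf.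
by rewrite (transversal_full tB cB).
Qed.

(** [lower f] is antisymmetric and lives on sets with one element fewer, none of which can be
    transversal. *)
Lemma antisym_full_harmonic f : antisym s f -> homogeneous (size s) f -> harmonic (size s) f.
Proof.
move=> af hf; split=> // C; move: C.
apply: (antisym_transversal (f := lower f) ds) => [p ps C|C tC].
  rewrite -(lower_imset (tperm p.1 p.2)) /lower -sumrN; apply: eq_bigr => x _.
  by rewrite -/(swap p _) af.
apply: big1 => x xC; apply: hf; rewrite cardsU1 xC neq_ltn; apply/orP; right.
move: tC; rewrite (transversalE s) => /andP[/subset_leq_card + _].
by rewrite (card_unzip1 ds).
Qed.

End FullAntisymmetry.

(** * From two-row tabloids to functions on m-subsets *)

Section TwoRowTabloids.
Local Open Scope ring_scope.
Variables (n m : nat).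
Hypothesis le_m : (m <= n - m)%N.
Local Notation la := [:: (n - m)%N; m].
Implicit Types (t : tableau n la) (Tb : tabloid n la) (B : {set 'I_n}).
Implicit Types v : permmod n la rat.

Definition row_top : 'I_(size la) := @Ordinal (size la) 0 isT.
Definition row_bot : 'I_(size la) := @Ordinal (size la) 1 isT.

Definition bottom Tb : {set 'I_n} := Tb row_bot.

Lemma row_top_or_bot (i : 'I_(size la)) : (i == row_top) || (i == row_bot).
Proof. by case: i => [[|[|]]]. Qed.

Lemma tableau_inj t : injective t.
Proof. by case/andP: (tab_entryP t) => /injectiveP. Qed.

Lemma tableau_surj t x : exists c, t c = x.
Proof.
by case/andP: (tab_entryP t) => _ /forallP/(_ x)/codomP[c ->]; exists c.
Qed.

Lemma mem_tab_rows t i c : (t c \in tab_rows t i) = (cell_row c == i).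
Proof. by rewrite ffunE mem_imset ?inE //; apply: tableau_inj. Qed.

Lemma tabloid_top Tb : Tb row_top = ~: bottom Tb.
Proof.
have /existsP[t /eqP Dt] := tabloid_rowsP Tb; rewrite /bottom Dt.
apply/setP => x; have [c <-] := tableau_surj t x; rewrite inE !mem_tab_rows.
by have := row_top_or_bot (cell_row c) => /orP[] /eqP->.
Qed.

Lemma bottom_inj : injective bottom.
Proof.
move=> Tb Tb' e; apply/val_inj/ffunP => i.
by case/orP: (row_top_or_bot i) => /eqP->; [rewrite [LHS]tabloid_top [RHS]tabloid_top e | apply: e].
Qed.

Definition bot_cell (i : 'I_m) : cell la :=
  Tagged (fun r : 'I_(size la) => 'I_(nth 0%N la r)) (i : 'I_(nth 0%N la row_bot)).
Definition top_cell (i : 'I_(n - m)) : cell la :=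
  Tagged (fun r : 'I_(size la) => 'I_(nth 0%N la r)) (i : 'I_(nth 0%N la row_top)).

Lemma cellP (c : cell la) : (exists i, c = bot_cell i) \/ (exists i, c = top_cell i).
Proof.
case: c => r; have /orP[] := row_top_or_bot r => /eqP-> i; [right|left]; by exists i.
Qed.

Lemma bot_cell_inj : injective bot_cell.
Proof. by move=> i j /(congr1 (@cell_col la)) /ord_inj. Qed.

Lemma top_cell_inj : injective top_cell.
Proof. by move=> i j /(congr1 (@cell_col la)) /ord_inj. Qed.

Lemma bottom_tabloid_of t : bottom (tabloid_of t) = [set t (bot_cell i) | i : 'I_m].
Proof.
apply/setP => x; have [c <-] := tableau_surj t x.
rewrite [LHS]mem_tab_rows; apply/eqP/imsetP => [|[i _ /tableau_inj->] //].
by case: (cellP c) => -[i ->] // _; exists i.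
Qed.

Lemma card_bottom Tb : #|bottom Tb| = m.
Proof.
have /existsP[t /eqP Dt] := tabloid_rowsP Tb.
have -> : Tb = tabloid_of t by apply/val_inj.
by rewrite bottom_tabloid_of card_imset ?card_ord // => i j /tableau_inj/bot_cell_inj.
Qed.

(* A tabloid of shape (n - m, m) is determined by its bottom row, so v becomes a
   function on sets, supported on the m-subsets. *)
Definition setfun v B := \sum_(Tb | bottom Tb == B) v Tb.

Lemma setfun_bottom v Tb : setfun v (bottom Tb) = v Tb.
Proof.
rewrite /setfun (bigD1 Tb) //= big1 ?addr0 // => Tb' /andP[/eqP/bottom_inj->].
by rewrite eqxx.
Qed.

Lemma setfun_inj v w : setfun v =1 setfun w -> v = w.
Proof. by move=> e; apply/ffunP => Tb; rewrite -!setfun_bottom e. Qed.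

Lemma setfun_homogeneous v : homogeneous m (setfun v).
Proof.
move=> B cB; apply: big1 => Tb /eqP DB.
by rewrite -DB card_bottom eqxx in cB.
Qed.

Lemma setfunD v w B : setfun (v + w) B = setfun v B + setfun w B.
Proof. by rewrite /setfun -big_split; apply: eq_bigr => Tb _; rewrite ffunE. Qed.

Lemma setfunN v B : setfun (- v) B = - setfun v B.
Proof. by rewrite /setfun -sumrN; apply: eq_bigr => Tb _; rewrite ffunE. Qed.

Lemma setfunZ a v B : setfun (a *: v) B = a * setfun v B.
Proof. by rewrite /setfun mulr_sumr; apply: eq_bigr => Tb _; rewrite ffunE. Qed.

Lemma setfun_sum (I : finType) (F : I -> permmod n la rat) B :
  setfun (\sum_i F i) B = \sum_i setfun (F i) B.
Proof.
rewrite /setfun exchange_big; apply: eq_bigr => Tb _; by rewrite sum_ffunE.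
Qed.

Lemma bottom_act g Tb : bottom (tabloid_act g Tb) = g @: bottom Tb.
Proof. by rewrite /bottom /= ffunE. Qed.

Lemma imsetVK (g : {perm 'I_n}) : cancel (fun B => g @: B) (fun B => g^-1%g @: B).
Proof.
move=> B; rewrite -imset_comp -[RHS]imset_id; apply: eq_imset => x /=.
by rewrite permK.
Qed.

Lemma tabloid_actVK g : cancel (@tabloid_act n la g) (tabloid_act g^-1).
Proof. by move=> Tb; apply: bottom_inj; rewrite !bottom_act imsetVK. Qed.

Lemma setfun_act g v B : setfun (mod_act g v) B = setfun v (g^-1%g @: B).
Proof.
rewrite /setfun (reindex_inj (can_inj (tabloid_actVK g))) /=.
apply: eq_big => [Tb|Tb _]; last by rewrite ffunE tabloid_actVK.
rewrite bottom_act; apply/eqP/eqP => [<-|->]; first by rewrite imsetVK.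
by have := imsetVK g^-1 B; rewrite invgK.
Qed.

Lemma setfun_swap p v B : setfun (mod_act (tperm p.1 p.2) v) B = setfun v (swap p B).
Proof. by rewrite setfun_act tpermV. Qed.

(** Bottom entries come first, so the set of first points is the bottom row of t, the m-subset
    attached to its tabloid. *)
Definition column_pairs t : seq ('I_n * 'I_n) :=
  [seq (t (bot_cell i), t (top_cell (widen_ord le_m i))) | i <- enum 'I_m].

Lemma unzip1_column_pairs t : unzip1 (column_pairs t) = [seq t (bot_cell i) | i <- enum 'I_m].
Proof. by rewrite /unzip1 /column_pairs -map_comp. Qed.

Lemma unzip2_column_pairs t : unzip2 (column_pairs t) =
  [seq t (top_cell (widen_ord le_m i)) | i <- enum 'I_m].
Proof. by rewrite /unzip2 /column_pairs -map_comp. Qed.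

Lemma size_column_pairs t : size (column_pairs t) = m.
Proof. by rewrite size_map -cardE card_ord. Qed.

Lemma disjoint_column_pairs t : disjoint_pairs (column_pairs t).
Proof.
rewrite /disjoint_pairs unzip1_column_pairs unzip2_column_pairs cat_uniq.
apply/and3P; split.
- by rewrite map_inj_uniq ?enum_uniq // => i j /tableau_inj/bot_cell_inj.
- apply/hasPn => x /mapP[i _ ->]; apply/mapP => -[j _] /=.
  by move=> /tableau_inj/(congr1 (@cell_row la)).
rewrite map_inj_uniq ?enum_uniq // => i j /tableau_inj/top_cell_inj/(congr1 (@nat_of_ord _)) e.
exact: ord_inj.
Qed.

Lemma col_stab_entry t g c : g \in col_stab t ->
  exists2 d, g (t c) = t d & cell_col c = cell_col d.
Proof.
rewrite inE => /forallP/(_ c)/forallP h.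
have [d Dd] := tableau_surj t (g (t c)); exists d => //.
by have /implyP/(_ _)/eqP := h d; apply; rewrite Dd.
Qed.

Lemma col_stabM t g h : g \in col_stab t -> h \in col_stab t -> (g * h)%g \in col_stab t.
Proof.
move=> gt ht; rewrite inE; apply/forallP => c; apply/forallP => d; apply/implyP.
have [c1 D1 ->] := col_stab_entry c gt; have [c2 D2 ->] := col_stab_entry c1 ht.
by rewrite permM D1 D2 => /eqP/tableau_inj->.
Qed.

Lemma col_stab_tperm t c d : cell_col c = cell_col d -> tperm (t c) (t d) \in col_stab t.
Proof.
move=> cd; rewrite inE; apply/forallP => x; apply/forallP => y; apply/implyP.
by case: tpermP => [/tableau_inj->|/tableau_inj->|_ _] /eqP/tableau_inj <-; rewrite ?cd.
Qed.

(** Right multiplication by the transposition permutes the column stabilizer and reverses every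
    sign. *)
Lemma mod_act_polytabloid t c d : c != d -> cell_col c = cell_col d ->
  mod_act (tperm (t c) (t d)) (polytabloid rat t) = - polytabloid rat t.
Proof.
move=> cd /(@col_stab_tperm t); set h := tperm _ _ => ht.
transitivity (\sum_(g in col_stab t)
    (-1) ^+ odd_perm g *: mod_act h (mod_basis rat (tabloid_of (tab_act g t)))).
  by apply/ffunP => U; rewrite !ffunE !sum_ffunE; apply: eq_bigr => g _; rewrite !ffunE.
rewrite /polytabloid -sumrN [RHS](reindex_inj (mulIg h)) /=.
apply: eq_big => [g|g _].
  by apply/idP/idP => [|gh]; [move/col_stabM; apply | rewrite -[g]mulg1 -(tperm2 (t c) (t d)) mulgA col_stabM].
rewrite mod_act_basis tabloid_act_of -scaleNr; congr (_ *: mod_basis rat (tabloid_of _)).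
  rewrite odd_permM odd_tperm (inj_eq (@tableau_inj t)) cd addbT.
  by rewrite signrN opprK.
by apply/val_inj/ffunP => e; rewrite !ffunE permM.
Qed.

Lemma antisym_polytabloid t : antisym (column_pairs t) (setfun (polytabloid rat t)).
Proof.
move=> p /mapP[i _ ->] B; rewrite -setfun_swap /= mod_act_polytabloid ?setfunN //.
Qed.

Lemma cell_eq (c d : cell la) : cell_row c = cell_row d -> cell_col c = cell_col d -> c = d.
Proof.
case: c d => r i [r' j] /= e; case: r' / e j => j /= e.
by congr Tagged; apply: ord_inj.
Qed.

Lemma col_stab_row_eq1 t g :
  g \in col_stab t -> tabloid_of t = tabloid_of (tab_act g t) -> g = 1%g.
Proof.
move=> gt e; apply/permP => x; rewrite perm1.
have [c <-] := tableau_surj t x; have [d Dd cd] := col_stab_entry c gt.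
rewrite Dd; congr (t _); apply: cell_eq => //.
have := mem_tab_rows (tab_act g t) (cell_row c) c; rewrite eqxx ffunE Dd.
have -> : tab_rows (tab_act g t) = tab_rows t by have := congr1 (@tabloid_rows n la) e.
by rewrite mem_tab_rows => /eqP.
Qed.

(** Only the identity preserves both rows and columns of t, so the coefficient at its own tabloid is
    1. *)
Lemma polytabloid_neq0 t : polytabloid rat t (tabloid_of t) != 0.
Proof.
have tab1 : tab_act 1%g t = t by apply/val_inj/ffunP => c; rewrite ffunE perm1.
have one : 1%g \in col_stab t.
  rewrite inE; apply/forallP => c; apply/forallP => d; apply/implyP.
  by rewrite perm1 => /eqP/tableau_inj->.
rewrite /polytabloid sum_ffunE (bigD1 1%g) //= big1 => [|g /andP[gt g1]].
  by rewrite !ffunE tab1 eqxx odd_perm1 addr0 scale1r oner_neq0.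
rewrite !ffunE; case: eqP => [/(col_stab_row_eq1 gt) e|_]; last by rewrite scaler0.
by rewrite e eqxx in g1.
Qed.

Lemma tab_act_trans t t' : exists g, tab_act g t = t'.
Proof.
have h x : x \in codom t by have [c <-] := tableau_surj t x; apply: codom_f.
have g_inj : injective (fun x => t' (iinv (h x))).
  by move=> x y /tableau_inj e; rewrite -(f_iinv (h x)) e f_iinv.
exists (perm g_inj); apply/val_inj/ffunP => c; rewrite ffunE permE.
by congr (t' _); apply: (@tableau_inj t); rewrite f_iinv.
Qed.

Lemma column_pairs_act g t :
  column_pairs (tab_act g t) = [seq (g p.1, g p.2) | p <- column_pairs t].
Proof. by rewrite -map_comp; apply: eq_map => i /=; rewrite !ffunE. Qed.

Lemma tableau_of_pairs (x0 : 'I_n) s : disjoint_pairs s -> size s = m ->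
  exists t, column_pairs t = s.
Proof.
move=> ds ss; pose bot := unzip1 s.
pose top := unzip2 s ++ [seq x <- enum 'I_n | x \notin bot ++ unzip2 s].
have s1 : size bot = m by rewrite size_map.
have u : uniq (bot ++ top).
  rewrite catA cat_uniq -/(disjoint_pairs s) ds filter_uniq ?enum_uniq // andbT.
  by apply/hasPn => x; rewrite mem_filter => /andP[].
have full x : x \in bot ++ top.
  rewrite catA mem_cat mem_filter mem_enum andbT.
  by case: (_ \in _).
have s2 : size top = (n - m)%N.
  have : #|bot ++ top| = #|'I_n| by apply: eq_card => x; rewrite full.
  by rewrite (card_uniqP u) size_cat s1 card_ord => e; rewrite -[in RHS]e addKn.
pose f := [ffun c : cell la =>
  nth x0 (if cell_row c == row_bot then bot else top) (cell_col c)].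
have fb i : f (bot_cell i) = nth x0 bot i by rewrite ffunE.
have ft i : f (top_cell i) = nth x0 top i by rewrite ffunE.
move: (u); rewrite cat_uniq => /and3P[ub /hasPn dis ut].
have f_inj : injective f.
  move=> c d; have [[i ->]|[i ->]] := cellP c; have [[j ->]|[j ->]] := cellP d;
    rewrite !(fb, ft) => e.
  - by congr bot_cell; apply/ord_inj/eqP; rewrite -(nth_uniq x0 _ _ ub) ?s1 ?e.
  - by have := dis _ (mem_nth x0 (_ : j < size top)%N); rewrite -e mem_nth ?s1 ?s2 // => /(_ (ltn_ord j)).
  - by have := dis _ (mem_nth x0 (_ : i < size top)%N); rewrite e mem_nth ?s1 ?s2 // => /(_ (ltn_ord i)).
  by congr top_cell; apply/ord_inj/eqP; rewrite -(nth_uniq x0 _ _ ut) ?s2 ?e.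
have ft_ok : is_tableau f.
  apply/andP; split; first exact/injectiveP.
  apply/forallP => x; have := full x; rewrite mem_cat => /orP[] xs; apply/codomP.
    have lt : (index x bot < m)%N by rewrite -s1 index_mem.
    by exists (bot_cell (Ordinal lt)); rewrite fb nth_index.
  have lt : (index x top < n - m)%N by rewrite -s2 index_mem.
  by exists (top_cell (Ordinal lt)); rewrite ft nth_index.
exists (Tableau ft_ok); apply: (@eq_from_nth _ (x0, x0)); rewrite size_column_pairs ?ss // => i im.
rewrite (nth_map (Ordinal im)) ?size_enum_ord //= fb ft /= nth_enum_ord //.
rewrite nth_cat size_map ss im /bot !(nth_map (x0, x0)) ?ss //.
by case: (nth _ _ _).
Qed.

End TwoRowTabloids.

(** * Coordinates in a basis over the integers *)

Section IntegralBases.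
Local Open Scope ring_scope.

Lemma common_denominator (I : finType) (a : I -> rat) :
  exists2 k : int, k != 0 & exists z : I -> int, forall i, k%:~R * a i = (z i)%:~R.
Proof.
exists (\prod_i denq (a i)); first by apply/prodf_neq0 => i _; apply: denq_neq0.
exists (fun i => numq (a i) * \prod_(j | j != i) denq (a j)) => i.
by rewrite (bigD1 i) //= !rmorphM /= numqE; ring.
Qed.

Variables (A : zmodType) (d : nat) (b : 'I_d -> A).
Hypothesis bP : forall x, exists! a : {ffun 'I_d -> int}, x = \sum_i b i *~ a i.

Lemma zcoord_subproof x : exists a : {ffun 'I_d -> int}, x == \sum_i b i *~ a i.
Proof. by have [a [/eqP xa _]] := bP x; exists a. Qed.

Definition zcoord x := xchoose (zcoord_subproof x).

Lemma zcoordK x : x = \sum_i b i *~ zcoord x i.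
Proof. exact/eqP/(xchooseP (zcoord_subproof x)). Qed.

Lemma zcoord_unique (a : {ffun 'I_d -> int}) x : x = \sum_i b i *~ a i -> zcoord x = a.
Proof.
by have [a' [_ ua]] := bP x => /ua <-; apply/esym/ua/zcoordK.
Qed.

Lemma zcoordB x y i : zcoord (x - y) i = zcoord x i - zcoord y i.
Proof.
rewrite (@zcoord_unique [ffun i => zcoord x i - zcoord y i]) ?ffunE //.
rewrite {1}(zcoordK x) {1}(zcoordK y) -sumrB; apply: eq_bigr => j _.
by rewrite ffunE mulrzBr.
Qed.

Lemma zcoord_basis i j : zcoord (b i) j = (i == j)%:R.
Proof.
rewrite (@zcoord_unique [ffun j => (i == j)%:R]) ?ffunE //.
rewrite (bigD1 i) //= ffunE eqxx big1 ?addr0 // => k ki.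
by rewrite ffunE eq_sym (negPf ki).
Qed.

(** Stated for a bare function, because [phi] is additive in its first argument only through a
    hypothesis. *)
Lemma additive_basis (g : A -> int) x : (forall x y, g (x + y) = g x + g y) ->
  g x = \sum_i zcoord x i * g (b i).
Proof.
move=> gD.
have gB : zmod_morphism g.
  by move=> y z; apply: (addIr (g z)); rewrite -gD !subrK.
pose gA : {additive A -> int} := HB.pack g (GRing.isZmodMorphism.Build _ _ g gB).
rewrite -[g x]/(gA x) {1}(zcoordK x) raddf_sum; apply: eq_bigr => i _.
by rewrite raddfMz -mulrzl intz.
Qed.

Lemma exists_coord_form i : exists g : {additive A -> int}, forall x, g x = zcoord x i.
Proof.
have gB : zmod_morphism (fun x => zcoord x i) by move=> x y; rewrite zcoordB.
pose g : {additive A -> int} :=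
  HB.pack (fun x => zcoord x i) (GRing.isZmodMorphism.Build _ _ (fun x => zcoord x i) gB).
by exists g.
Qed.

End IntegralBases.

(** * The standard form on set functions *)

Section SetFunctionForm.
Local Open Scope ring_scope.
Variable T : finType.
Implicit Types f h : {set T} -> rat.

Definition dotf f h := \sum_B f B * h B.

Lemma dotfC f h : dotf f h = dotf h f.
Proof. by apply: eq_bigr => B _; rewrite mulrC. Qed.

Lemma dotf_sumr (I : finType) (a : I -> rat) (F : I -> {set T} -> rat) f :
  dotf f (fun B => \sum_i a i * F i B) = \sum_i a i * dotf f (F i).
Proof.
rewrite /dotf; under eq_bigr do rewrite mulr_sumr.
rewrite exchange_big; apply: eq_bigr => i _; rewrite mulr_sumr.
by apply: eq_bigr => B _; rewrite mulrCA.
Qed.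

Lemma dotf_neq0 f : (exists B, f B != 0) -> dotf f f != 0.
Proof.
case=> B fB; rewrite psumr_eq0 => [|C _]; last by rewrite -expr2 sqr_ge0.
by apply/allPn; exists B; rewrite ?mem_index_enum //= mulf_eq0 orbb.
Qed.

(** The antisymmetrization of h lies on the line of f, with ratio read off at A, and adjointness
    relates its product with f to that of h. *)
Lemma dotf_antisym_full s f h : disjoint_pairs s -> antisym s f ->
  homogeneous (size s) f -> homogeneous (size s) h ->
  let A := [set x in unzip1 s] in
  2 ^+ size s * f A * dotf f h = antisymmetrize s h A * dotf f f.
Proof.
move=> ds af hf hh A.
have akh := antisymmetrize_antisym h ds.
rewrite mulrAC -/(dotf _ _) -sum_antisym_antisymmetrize // mulr_suml mulr_sumr.
apply: eq_bigr => B _; rewrite -mulrA.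
have e := antisym_full_eq ds akh af (homogeneous_antisymmetrize s hh) hf B.
by rewrite -/A in e; rewrite e; ring.
Qed.

Lemma harmonic_ext m f h :
  f =1 h -> harmonic m h -> harmonic m f.
Proof.
move=> fh [hh lh]; split=> [B /hh|C]; first by rewrite fh.
by rewrite -(lh C); apply: eq_bigr => x _; rewrite fh.
Qed.

Lemma harmonic_sum m (I : finType) (a : I -> rat) (F : I -> {set T} -> rat) :
  (forall i, harmonic m (F i)) -> harmonic m (fun B => \sum_i a i * F i B).
Proof.
move=> hF; split=> [B cB|C]; first by apply: big1 => i _; have [-> //] := hF i; rewrite mulr0.
rewrite /lower exchange_big big1 //= => i _; rewrite -mulr_sumr.
by have [_ h] := hF i; rewrite -/(lower (F i) C) h mulr0.
Qed.

(** A nonzero f has a nonzero antisymmetrization for some system of m pairs, and [dotf_antisym_full]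
    then makes its product with any nonzero x on that line nonzero. This does the work of
    irreducibility. *)
Lemma harmonic_perp m f : harmonic m f ->
  (forall s, disjoint_pairs s -> size s = m -> exists x,
     [/\ antisym s x, homogeneous m x, exists B, x B != 0 & dotf x f = 0]) ->
  forall B, f B = 0.
Proof.
move=> hf perp B; apply: contraTeq isT => fB.
have [|s [ss ds kf]] := exists_antisymmetrize hf _ (leqnn m); first by exists B.
have [x [ax hx x0 xf]] := perp s ds ss; have [homf _] := hf.
rewrite -{1}ss in hx; rewrite -{1}ss in homf; have := dotf_antisym_full ds ax hx homf.
rewrite /= xf mulr0 => /esym/eqP; rewrite mulf_eq0 (negPf (dotf_neq0 x0)) orbF.
apply: contraLR => _; apply: (antisym_full_neq0 ds) => //.
  exact: antisymmetrize_antisym.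
exact: homogeneous_antisymmetrize.
Qed.

End SetFunctionForm.

(** * Full lattices in the Specht module and isomorphisms with their duals *)

Section SpechtLattice.
Local Open Scope ring_scope.
Variables (n m : nat).
Hypothesis le_m : (m <= n - m)%N.
Hypothesis m_gt0 : (0 < m)%N.
Local Notation la := [:: (n - m)%N; m].
Local Notation Sp := (specht_rat n la).

Lemma harmonic_polytabloid (t : tableau n la) : harmonic m (setfun (polytabloid rat t)).
Proof.
rewrite -{1}(size_column_pairs le_m t); apply: antisym_full_harmonic.
- exact: disjoint_column_pairs.
- exact: antisym_polytabloid.
by rewrite size_column_pairs; apply: setfun_homogeneous.
Qed.

Lemma harmonic_specht v : v \in Sp -> harmonic m (setfun v).
Proof.
pose X := [tuple of [seq polytabloid rat t | t : tableau n la]].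
move=> vS; have /coord_span -> : v \in <<X>>%VS by [].
have hX i : harmonic m (setfun X`_i).
  have [iX|iX] := ltnP i (size X); last first.
    rewrite nth_default //; split=> [B _|C]; first by apply: big1 => Tb _; rewrite ffunE.
    by apply: big1 => x _; apply: big1 => Tb _; rewrite ffunE.
  by have /mapP[t _ ->] := mem_nth 0 iX; apply: harmonic_polytabloid.
have := harmonic_sum (fun i => coord X i v) (F := fun i => setfun X`_i) (fun i => hX i).
by apply: harmonic_ext => B; rewrite setfun_sum; apply: eq_bigr => i _; rewrite setfunZ.
Qed.

Variable X : full_lattice Sp.
Local Notation A := (sub_elt X).
Implicit Types x y : A.

Definition latfun x : {set 'I_n} -> rat := setfun (val x).

Lemma latfun_inj x y : latfun x =1 latfun y -> x = y.
Proof. by move=> e; apply/val_inj/setfun_inj. Qed.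

Lemma latfun_homogeneous x : homogeneous m (latfun x).
Proof. exact: setfun_homogeneous. Qed.

Lemma latfun_harmonic x : harmonic m (latfun x).
Proof. exact/harmonic_specht/lat_sub/valP. Qed.

Lemma latfunB x y B : latfun (x - y) B = latfun x B - latfun y B.
Proof. by rewrite /latfun raddfB setfunD setfunN. Qed.

Lemma latfunMz x (k : int) B : latfun (x *~ k) B = k%:~R * latfun x B.
Proof. by rewrite /latfun raddfMz -scaler_int setfunZ. Qed.

Lemma latfun_act g x B : latfun (lat_act g x) B = latfun x (g^-1%g @: B).
Proof. exact: setfun_act. Qed.

Lemma latfun_swap p x B : latfun (lat_act (tperm p.1 p.2) x) B = latfun x (swap p B).
Proof. exact: setfun_swap. Qed.

Lemma latfun_sum (I : finType) (F : I -> A) B : latfun (\sum_i F i) B = \sum_i latfun (F i) B.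
Proof. by rewrite /latfun raddf_sum setfun_sum. Qed.

Definition lat_antisymmetrize (s : seq ('I_n * 'I_n)) y :=
  foldr (fun p z => z - lat_act (tperm p.1 p.2) z) y s.

Lemma latfun_antisymmetrize s y : latfun (lat_antisymmetrize s y) =1 antisymmetrize s (latfun y).
Proof.
elim: s => [|p s IH] //= B.
by rewrite latfunB latfun_swap !IH.
Qed.

Lemma latfun_comb d (b : 'I_d -> A) (a : 'I_d -> int) B :
  latfun (\sum_i b i *~ a i) B = \sum_i (a i)%:~R * latfun (b i) B.
Proof. by rewrite latfun_sum; apply: eq_bigr => i _; rewrite latfunMz. Qed.

Section Basis.
Variable b : 'I_(\dim Sp) -> A.
Hypothesis bP : forall x, exists! a : {ffun 'I_(\dim Sp) -> int}, x = \sum_i b i *~ a i.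

Lemma lat_basis_free (u : 'I_(\dim Sp) -> rat) :
  (forall B, \sum_i u i * latfun (b i) B = 0) -> forall i, u i = 0.
Proof.
move=> u0 i; have [k k0 [z zE]] := common_denominator u.
have kQ : k%:~R != 0 :> rat by rewrite intr_eq0.
have z0 : 0 = \sum_i b i *~ [ffun i => z i] i.
  apply: latfun_inj => B; rewrite latfun_comb.
  transitivity (k%:~R * \sum_i u i * latfun (b i) B).
    by rewrite u0 mulr0 /latfun raddf0; apply: big1 => Tb _; rewrite ffunE.
  by rewrite mulr_sumr; apply: eq_bigr => j _; rewrite ffunE -zE mulrA.
have [a [_ ua]] := bP 0.
have : a = [ffun=> 0] by apply: ua; rewrite big1 // => j _; rewrite ffunE mulr0z.
rewrite (ua _ z0) => /ffunP/(_ i); rewrite !ffunE => zi.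
by apply/eqP; move/eqP: (zE i); rewrite zi mulf_eq0 (negPf kQ).
Qed.

(** The rank is the dimension of the Specht module, so the lattice basis is also a rational basis,
    and k clears the denominators of the coordinates. *)
Lemma lat_multiple v : v \in Sp -> exists2 k : int, k != 0 & exists x, val x = k%:~R *: v.
Proof.
pose bt := [tuple val (b i) | i < \dim Sp].
have btE (i : 'I_(\dim Sp)) : bt`_i = val (b i) by rewrite (nth_mktuple _ 0).
have bt_free : free bt.
  apply/freeP => u u0; apply: lat_basis_free => B.
  transitivity (setfun (\sum_i u i *: bt`_i) B).
    by rewrite setfun_sum; apply: eq_bigr => i _; rewrite setfunZ btE.
  by rewrite u0; apply: big1 => Tb _; rewrite ffunE.
have bt_basis : basis_of Sp bt.
  rewrite basisEfree bt_free size_tuple leqnn andbT; apply/span_subvP => w /tnthP[i ->].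
  by rewrite tnth_mktuple; apply/lat_sub/valP.
move=> vS; rewrite -(span_basis bt_basis) in vS.
have [k k0 [z zE]] := common_denominator (fun i => coord bt i v).
exists k => //; exists (\sum_i b i *~ z i).
rewrite (coord_span vS) scaler_sumr raddf_sum; apply: eq_bigr => i _.
by rewrite raddfMz scalerA zE scaler_int btE.
Qed.

End Basis.

Section Form.
Variable phi : A -> {additive A -> int}.
Hypothesis phi_iso : dual_iso phi.

Lemma phiD z x y : phi (x + y) z = phi x z + phi y z.
Proof. by case: phi_iso. Qed.

Lemma phi_act g x y : phi (lat_act g x) y = phi x (lat_act g^-1%g y).
Proof. by case: phi_iso. Qed.

Lemma phiN x z : phi (- x) z = - phi x z.
Proof.
apply: (addrI (phi x z)); rewrite -phiD !subrr.
by apply: (addrI (phi 0 z)); rewrite -phiD !addr0.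
Qed.

(** Invariance moves each transposition onto x, where it acts as -1. *)
Lemma phi_antisymmetrize s x y : antisym s (latfun x) ->
  phi x (lat_antisymmetrize s y) = 2 ^+ size s * phi x y.
Proof.
elim: s => [|p s IH] af /=; first by rewrite mul1r.
have [ap afs] := antisym_cons af.
have px : lat_act (tperm p.1 p.2) x = - x.
  by apply: latfun_inj => B; rewrite latfun_swap ap /latfun raddfN setfunN.
by rewrite raddfB -[tperm p.1 p.2]tpermV -phi_act px phiN IH // exprS; ring.
Qed.

(** The antisymmetrization z of y is a rational multiple of x, and in both forms pairing x with z
    gives 2^m times its pairing with y. *)
Lemma phi_antisym_full s x y : disjoint_pairs s -> size s = m -> antisym s (latfun x) ->
  (exists B, latfun x B != 0) ->
  (phi x y)%:~R * dotf (latfun x) (latfun x) = (phi x x)%:~R * dotf (latfun x) (latfun y).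
Proof.
move=> ds ss ax x0; set S := [set z in unzip1 s].
have hx : homogeneous (size s) (latfun x) by rewrite ss; apply: latfun_homogeneous.
have hy : homogeneous (size s) (latfun y) by rewrite ss; apply: latfun_homogeneous.
have xS0 : latfun x S != 0 by apply: antisym_full_neq0.
set z := lat_antisymmetrize s y.
have az : antisym s (latfun z).
  by move=> p ps B; rewrite !latfun_antisymmetrize antisymmetrize_antisym.
have hz : homogeneous (size s) (latfun z) by rewrite ss; apply: latfun_homogeneous.
have zx := antisym_full_eq ds az ax hz hx; rewrite -/S in zx.
have := dotf_antisym_full ds ax hx hy; rewrite /= -/S -latfun_antisymmetrize -/z => dxy.
(* [phi] accepts only lattice elements, so the proportionality of z and x is stated with
   denominators cleared. *)
pose a (i : bool) := if i then latfun x S else latfun z S.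
have [k k0 [u uE]] := common_denominator a.
have kQ : k%:~R != 0 :> rat by rewrite intr_eq0.
have zuxu : z *~ u true = x *~ u false.
  apply: latfun_inj => B; rewrite !latfunMz -!uE /a /= -!mulrA; congr (_ * _).
  by rewrite mulrC zx mulrC.
have := congr1 (phi x) zuxu; rewrite !raddfMz /= phi_antisymmetrize //.
move/(congr1 (fun i : int => i%:~R : rat)).
rewrite !mulrzz !rmorphM /= -!uE /a /= rmorphXn /= => e.
apply: (mulfI xS0); apply: (mulfI (expf_neq0 (size s) (_ : 2 != 0 :> rat))) => //.
apply: (mulfI kQ).
transitivity ((phi x x)%:~R * (k%:~R * latfun z S) * dotf (latfun x) (latfun x)).
  by rewrite -e; ring.
transitivity ((phi x x)%:~R * k%:~R * (latfun z S * dotf (latfun x) (latfun x))); first by ring.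
by rewrite -dxy; ring.
Qed.

(** c is computed from a multiple [x0] of one polytabloid. Translates of [x0] serve all systems of m
    pairs, and c does not change because both forms are invariant. *)
Lemma exists_antisym_vectors : (2 * m <= n)%N -> exists c : rat,
  forall s, disjoint_pairs s -> size s = m -> exists x,
    [/\ antisym s (latfun x), exists B, latfun x B != 0 &
        forall y, (phi x y)%:~R = c * dotf (latfun x) (latfun y)].
Proof.
move=> mn; have n0 : (0 < n)%N by lia.
pose i0 := Ordinal n0.
have [|s0 ss0 ds0] := @exists_disjoint_pairs 'I_n m; first by rewrite card_ord.
have [t0 Dt0] := tableau_of_pairs le_m i0 ds0 ss0.
have [b bP] := lat_free X.
have [|k k0 [x0 Dx0]] := @lat_multiple b bP (polytabloid rat t0).
  by apply: memv_span; apply/mapP; exists t0; rewrite ?mem_enum.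
have kQ : k%:~R != 0 :> rat by rewrite intr_eq0.
have fx0 B : latfun x0 B = k%:~R * setfun (polytabloid rat t0) B.
  by rewrite /latfun Dx0 setfunZ.
have ax0 : antisym (column_pairs le_m t0) (latfun x0).
  by move=> p ps B; rewrite !fx0 (antisym_polytabloid ps) mulrN.
have x0_neq0 : exists B, latfun x0 B != 0.
  exists (bottom (tabloid_of t0)); rewrite fx0 setfun_bottom.
  by rewrite mulf_neq0 ?polytabloid_neq0.
exists ((phi x0 x0)%:~R / dotf (latfun x0) (latfun x0)) => s ds ss.
have [t Dt] := tableau_of_pairs le_m i0 ds ss.
have [g Dg] := tab_act_trans t0 t; exists (lat_act g x0).
have ax : antisym s (latfun (lat_act g x0)).
  rewrite -Dt -Dg column_pairs_act => _ /mapP[q qs ->] B /=.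
  rewrite !latfun_act -(ax0 q qs); congr (latfun x0 _).
  have mem_imV (z : 'I_n) (C : {set 'I_n}) : (z \in g^-1%g @: C) = (g z \in C).
    by rewrite -{1}(permK g z) mem_imset //; apply: perm_inj.
  by apply/setP => z; rewrite mem_imV !mem_swap mem_imV /= inj_tperm //; apply: perm_inj.
have x_neq0 : exists B, latfun (lat_act g x0) B != 0.
  by have [B xB] := x0_neq0; exists (g @: B); rewrite latfun_act imsetVK.
have dx : dotf (latfun (lat_act g x0)) (latfun (lat_act g x0)) = dotf (latfun x0) (latfun x0).
  rewrite /dotf (reindex_inj (can_inj (imsetVK g))).
  by apply: eq_bigr => B _; rewrite latfun_act imsetVK.
have px : phi (lat_act g x0) (lat_act g x0) = phi x0 x0.
  by rewrite phi_act; congr (phi x0 _); apply: latfun_inj => B; rewrite !latfun_act invgK imsetVK.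
split=> // y; have := phi_antisym_full y ds ss ax x_neq0; rewrite dx px => e.
have d0 := dotf_neq0 x0_neq0.
by apply: (mulIf d0); rewrite e; field.
Qed.

Lemma lattice_unimodular_data : (2 * m <= n)%N ->
  exists (d : nat) (b : 'I_d -> {set 'I_n} -> rat) (G : 'M[int]_d) (c : rat),
  [/\ forall i, harmonic m (b i),
      forall f, harmonic m f -> exists a : 'I_d -> rat, forall B, f B = \sum_i a i * b i B,
      forall p, exists E : 'M[int]_d, forall i B, b i (swap p B) = \sum_j (E i j)%:~R * b j B,
      forall i j, (G i j)%:~R = c * \sum_B b i B * b j B &
      G \in unitmx].
Proof.
move=> mn; have [b bP] := lat_free X.
have [c vec] := exists_antisym_vectors mn.
set d := \dim Sp in b bP.
pose bf i := latfun (b i).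
have hb i : harmonic m (bf i) by apply: latfun_harmonic.
have xE x B : latfun x B = \sum_i (zcoord bP x i)%:~R * bf i B.
  by rewrite {1}(zcoordK bP x) latfun_comb.
have perp f : harmonic m f -> (forall i, dotf (bf i) f = 0) -> forall B, f B = 0.
  move=> hf f0; apply: (harmonic_perp hf) => s ds ss; have [x [ax x0 _]] := vec s ds ss.
  exists (latfun x); split=> //; first exact: latfun_homogeneous.
  rewrite dotfC /dotf; under eq_bigr do rewrite xE.
  by rewrite -/(dotf _ _) dotf_sumr big1 // => i _; rewrite dotfC f0 mulr0.
pose gram : 'M[rat]_d := \matrix_(i, j) dotf (bf i) (bf j).
have comb_gram (u : 'rV_d) j : dotf (bf j) (fun B => \sum_i u 0 i * bf i B) = (u *m gram) 0 j.
  rewrite dotf_sumr mxE; apply: eq_bigr => i _.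
  by rewrite mxE dotfC.
have ugram : gram \in unitmx.
  rewrite unitmxE unitfE; apply/det0P => -[u u0 ug].
  case/eqP: u0.
  apply/rowP => i; rewrite mxE.
  apply: (lat_basis_free bP (u := fun i => u 0 i)) => B.
  apply: (perp (fun B => \sum_i u 0 i * bf i B)) => [|j]; first exact: harmonic_sum.
  by rewrite comb_gram ug mxE.
pose G : 'M[int]_d := \matrix_(i, j) phi (b i) (b j).
have phiE x y : phi x y = \sum_i zcoord bP x i * phi (b i) y.
  by apply: (additive_basis bP (g := fun x => phi x y)) => z t; apply: phiD.
have GE : map_mx intr G = c *: gram.
  (* Column j of [M] holds the coordinates of the harmonic function that represents the discrepancy
     of the two forms against b_j; [px] makes it orthogonal to the vectors that detect harmonic
     functions. *)
  pose M := invmx gram *m (map_mx intr G - c *: gram).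
  suff M0 : M = 0.
    by apply/eqP; rewrite -subr_eq0 -[X in X == 0](mulKVmx ugram) -/M M0 mulmx0.
  apply/matrixP => i j; rewrite [RHS]mxE; move: i.
  apply: (lat_basis_free bP (u := fun i => M i j)) => B.
  apply: (harmonic_perp (m := m) (f := fun B => \sum_i M i j * bf i B)).
    exact: harmonic_sum.
  move=> s ds ss; have [x [ax x0 px]] := vec s ds ss.
  exists (latfun x); split=> //; first exact: latfun_homogeneous.
  pose a : 'rV[rat]_d := \row_k (zcoord bP x k)%:~R.
  have xa i : dotf (latfun x) (bf i) = (a *m gram) 0 i.
    rewrite dotfC -comb_gram; apply: eq_bigr => C _; rewrite xE.
    by congr (_ * _); apply: eq_bigr => k _; rewrite mxE.
  transitivity ((a *m gram *m M) 0 j).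
    by rewrite dotf_sumr mxE; apply: eq_bigr => i _; rewrite xa mulrC.
  rewrite -mulmxA mulKVmx // mulmxBr -scalemxAr mxE [X in _ + X]mxE [X in _ - X]mxE -xa -px.
  apply/eqP; rewrite subr_eq0 mxE phiE rmorph_sum; apply/eqP/eq_bigr => k _.
  by rewrite !mxE rmorphM.
exists d, bf, G, c; split=> //.
(* Orthogonal projection to the span of the basis: the remainder is harmonic and orthogonal to X,
   hence 0. *)
- move=> f hf; pose r := \row_j dotf (bf j) f.
  pose u := r *m invmx gram; exists (fun i => u 0 i) => B.
  apply/eqP; rewrite -subr_eq0; apply/eqP.
  apply: (perp (fun B => f B - \sum_i u 0 i * bf i B)) => [|j].
    by apply: harmonicB => //; apply: harmonic_sum.
  rewrite /dotf; under eq_bigr do rewrite mulrBr.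
  by rewrite sumrB -!/(dotf _ _) comb_gram mulmxKV // mxE subrr.
- move=> p; exists (\matrix_(i, j) zcoord bP (lat_act (tperm p.1 p.2) (b i)) j) => i B.
  by rewrite [LHS]/bf -latfun_swap xE; apply: eq_bigr => j _; rewrite mxE.
- by move=> i j; have := congr1 (fun M : 'M_d => M i j) GE; rewrite !mxE.
(* Surjectivity of [phi] provides a dual basis [K], whose coordinate matrix inverts [G]. *)
have [K KP] : exists K : 'I_d -> A, forall j y, phi (K j) y = zcoord bP y j.
  have [_ _ _ surj] := phi_iso.
  have/fin_all_exists[K KP] j : exists x, forall y, phi x y = zcoord bP y j.
    have [g gE] := exists_coord_form bP j; have [x xg] := surj g.
    by exists x => y; rewrite xg gE.
  by exists K.
have KG : (\matrix_(j, i) zcoord bP (K j) i) *m G = 1%:M.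
  apply/matrixP => j i; transitivity (phi (K j) (b i)).
    by rewrite mxE phiE; apply: eq_bigr => k _; rewrite !mxE.
  by rewrite KP zcoord_basis mxE eq_sym; case: (j == i).
by case: (mulmx1_unit KG).
Qed.

End Form.
End SpechtLattice.

Theorem theorem2p13 (n m : nat) (hm3 : 3 <= m) (hmn : 2 * m <= n)
  : ~ exists X : full_lattice (specht_rat n [:: n - m; m]), unimodular X.
Proof.
case=> X [phi phi_iso].
have le_m : m <= n - m by lia.
have m_gt0 : 0 < m by lia.
have [d [b [G [c [h1 h2 h3 h4 h5]]]]] := lattice_unimodular_data le_m m_gt0 phi_iso hmn.
by apply: (no_unimodular_invariant_lattice h1 h2 h3 h4 h5); rewrite ?card_ord.
Qed.
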